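(* Let $\Sigma=(B,\sigma)$ be a signed graph whose underlying graph $B$ is a block that is neither a single edge nor a circle. Let $e$ be an edge of $B$ and $C$ a circle of $B$ containing $e$. Then $e$ is a battery with circle $C$ (i.e. either $[e,C,-]$ or $[e,C,+]$ holds) if and only if $B$ is $C$-layered, $e$ lies in a handle of $C$, and one of the following holds: (1) the other handle of $C$ (the one not containing $e$) contains a balancing edge of $\Sigma$; in this case $[e,C,-]$ is a negative battery; (2) for every bridge $D$ of $C$ and every path $P$ through $D$, with endpoints $u\neq w$, both circles formed by $P$ together with one of the two $u$–$w$ paths of $C$ are negative; in this case $[e,C,+]$ is a positive battery.
   Context: A signed graph $\Sigma=(G,\sigma)$ is a finite graph $G$ with signature $\sigma:E(G)\to\{+,-\}$. A circle is a connected 2-regular subgraph; its sign is the product of its edge signs. A (sub)graph is balanced if all its circles are positive. Switching by $\zeta:V(G)\to\{+,-\}$ replaces $\sigma(e)$ by $\zeta(u)\sigma(e)\zeta(w)$ for each edge $e$ with endpoints $u,w$. An edge $b$ is a balancing edge of $\Sigma$ if $\Sigma$ can be switched to a signature in which $b$ is the only negative edge. A block is a maximal subgraph without a cutpoint. For a circle $C$, a chord is an edge not in $C$ joining two distinct vertices of $C$; a bridge of $C$ is either a chord of $C$ or a connected component $D$ of $G\setminus V(C)$ together with all edges joining $D$ to $C$; its vertices of attachment are its vertices on $C$; a path through a bridge $D$ is a path in $D$ whose endpoints are two distinct vertices of attachment of $D$. Two chords $c_1,c_2$ of $C$ cross if $C\cup c_1\cup c_2$ is a subdivision of $K_4$.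 The endpoints of chords partition $C$ into paths called segments; a segment is a handle if its two endpoints are joined by a chord. A circle with chords is 2-handled if no two chords cross and there are exactly two handles. If every bridge of $C$ has exactly two vertices of attachment, $C^*$ is obtained from $C$ by adding, for each bridge, one chord joining its two vertices of attachment; segments and handles of $C$ are then those determined by $C^*$. The graph is $C$-layered if every bridge of $C$ has exactly two vertices of attachment and $C^*$ is 2-handled. An edge $e$ is a negative battery with circle $C$, written $[e,C,-]$, if $C$ is a negative circle containing $e$ and is the only negative circle containing $e$; it is a positive battery $[e,C,+]$ if $C$ is a positive circle containing $e$ and is the only positive circle containing $e$. *)

(* Defs.v *)
From mathcomp Require Import all_boot.
Set Implicit Arguments. Unset Strict Implicit. Unset Printing Implicit Defensive.

(* A graph: finite vertex type V, finite edge type E, and [ends e] = the two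
   endpoints of edge e (a loop has equal endpoints).  A signature is given by
   [neg : E -> bool], with [neg e = true] meaning sigma(e) = -.
   Subgraphs without isolated vertices (circles, paths, bridges' edge sets)
   are represented by their edge sets. *)

Section SignedGraphs.
Variables (V E : finType) (ends : E -> V * V).

Definition incident (f : E) (v : V) : bool := ((ends f).1 == v) || ((ends f).2 == v).

Definition verts (F : {set E}) : {set V} := [set v | [exists f in F, incident f v]].

(* degree of v in the subgraph F (a loop counts twice) *)
Definition deg (F : {set E}) (v : V) : nat :=
  #|[set f in F | (ends f).1 == v]| + #|[set f in F | (ends f).2 == v]|.

Definition adjF (F : {set E}) : rel V := fun u w =>
  [exists f in F, (((ends f).1 == u) && ((ends f).2 == w))
                  || (((ends f).1 == w) && ((ends f).2 == u))].

Definition connectedE (F : {set E}) : Prop :=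
  F != set0 /\ forall u w, u \in verts F -> w \in verts F -> connect (adjF F) u w.

Definition isCircle (C : {set E}) : Prop :=
  connectedE C /\ forall v, v \in verts C -> deg C v = 2.

Definition isPath (P : {set E}) (u w : V) : Prop :=
  [/\ u != w, connectedE P, u \in verts P, w \in verts P &
   [/\ deg P u = 1, deg P w = 1 &
       forall v, v \in verts P -> v != u -> v != w -> deg P v = 2]].

Definition connectedG : Prop :=
  (exists v : V, True) /\ forall u w : V, connect (adjF setT) u w.

Definition cutpoint (v : V) : Prop :=
  exists E1 E2 : {set E}, [/\ E1 != set0, E2 != set0, E1 :&: E2 = set0,
    E1 :|: E2 = setT &
    forall x, x \in verts E1 -> x \in verts E2 -> x = v].

Definition isBlock : Prop := connectedG /\ forall v, ~ cutpoint v.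

Definition isSingleEdge : Prop := connectedG /\ #|E| = 1.

Definition isCircleGraph : Prop := isCircle setT /\ verts setT = setT.

Definition isChord (C : {set E}) (c : E) : Prop :=
  [/\ c \notin C, (ends c).1 \in verts C, (ends c).2 \in verts C &
      (ends c).1 != (ends c).2].

Definition adjOff (C : {set E}) : rel V := fun u w =>
  [&& u \notin verts C, w \notin verts C & adjF setT u w].

Definition isComp (C : {set E}) (D : {set V}) : Prop :=
  exists v, v \notin verts C /\
    D = [set w | (w \notin verts C) && connect (adjOff C) v w].

Definition compEdges (D : {set V}) : {set E} :=
  [set f | ((ends f).1 \in D) || ((ends f).2 \in D)].

Definition isBridge (C : {set E}) (D : {set V}) (F : {set E}) : Prop :=
  (D = set0 /\ exists c, isChord C c /\ F = [set c]) \/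
  (isComp C D /\ F = compEdges D).

Definition att (C : {set E}) (F : {set E}) : {set V} := verts C :&: verts F.

(* v is a vertex of attachment of some bridge (= an endpoint of a chord of C* ) *)
Definition attPt (C : {set E}) (v : V) : Prop :=
  exists D F, isBridge C D F /\ v \in att C F.

Definition segment (C Q : {set E}) (u w : V) : Prop :=
  [/\ Q \subset C, isPath Q u w, attPt C u, attPt C w &
      forall v, v \in verts Q -> v != u -> v != w -> ~ attPt C v].

(* a handle: a segment whose endpoints are joined by a chord of C*, i.e. are
   the two vertices of attachment of some bridge *)
Definition isHandle (C Q : {set E}) : Prop :=
  exists u w, segment C Q u w /\
    exists D F, isBridge C D F /\ att C F = [set u; w].

(* chords {a,b} and {c,d} of C* cross (C + both chords is a subdivision of K4):
   a,b,c,d distinct and c, d lie on different a-b paths of C *)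
Definition crossing (C : {set E}) (a b c d : V) : Prop :=
  [/\ [&& a != b, a != c, a != d, b != c, b != d & c != d],
      [&& a \in verts C, b \in verts C, c \in verts C & d \in verts C] &
      forall Q : {set E}, Q \subset C -> isPath Q a b -> (c \in verts Q) != (d \in verts Q)].

Definition twoHandled (C : {set E}) : Prop :=
  (forall D1 F1 D2 F2 a b c d, isBridge C D1 F1 -> isBridge C D2 F2 ->
      att C F1 = [set a; b] -> att C F2 = [set c; d] -> ~ crossing C a b c d) /\
  (exists H1 H2, [/\ H1 <> H2, isHandle C H1, isHandle C H2 &
       forall H, isHandle C H -> H = H1 \/ H = H2]).

Definition layered (C : {set E}) : Prop :=
  (forall D F, isBridge C D F -> #|att C F| = 2) /\ twoHandled C.

Definition pathThrough (C : {set E}) (F P : {set E}) (u w : V) : Prop :=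
  [/\ P \subset F, isPath P u w, u \in att C F, w \in att C F &
      verts P :&: verts C = [set u; w]].

Variable neg : E -> bool.

Definition negS (F : {set E}) : bool := odd #|[set f in F | neg f]|.

(* b is a balancing edge: some switching makes b the only negative edge *)
Definition balancing (b : E) : Prop :=
  exists z : V -> bool, forall f : E,
    (neg f (+) z (ends f).1 (+) z (ends f).2) = (f == b).

Definition negBattery (e : E) (C : {set E}) : Prop :=
  [/\ isCircle C, e \in C, negS C &
      forall C', isCircle C' -> e \in C' -> negS C' -> C' = C].

Definition posBattery (e : E) (C : {set E}) : Prop :=
  [/\ isCircle C, e \in C, ~~ negS C &
      forall C', isCircle C' -> e \in C' -> ~~ negS C' -> C' = C].

End SignedGraphs.

(* Main.v *)
Require Import Defs.
From mathcomp Require Import all_boot zify.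
Set Implicit Arguments. Unset Strict Implicit. Unset Printing Implicit Defensive.

(** All circles through e other than C have the sign opposite to that of C, so no
    set of four circles through e that includes C can have mod 2 sum zero.  A bridge
    with three attachments, two crossing bridges, or two bridges spanning
    edge-disjoint arcs of C - e would each give such a set; hence the arcs of C - e
    spanned by the bridges are nested, the innermost one is the handle avoiding e and
    the complement of the outermost one is the handle containing e.

    Conversely, when the arcs are nested, the two attachments of any bridge F separate
    F, the side of e and the side of the inner handle from one another.  A circle has
    at most two passages through a separating pair, so C is the only circle through e
    and an edge of the inner handle, and every other circle through e consists of a
    path through one bridge and an arc of C.

    If C is the only negative circle through e, flipping the sign of an edge b of the
    inner handle makes all circles through e positive.  An ear decomposition starting
    from C then shows that the flipped block is balanced: b is a balancing edge. *)

(** * Paths and circles as edge sets *)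

(** Paths and circles are sets of edges recognised by connectedness and degrees, so concatenation,
    complement and sum are settled by counting degrees, and signs are sums mod 2 over edges. An
    order is needed only to compare bridges: cutting C at e makes its vertices the positions 0 to n,
    and crossing, nesting and disjointness of bridges become linear inequalities. Arcs given by
    positions avoid e, their complements contain it, and this is what tells the two handles apart.

    Both signs are treated at once: until the last steps only the opposition between C and the other
    circles through e matters.

    In the converse the delicate point is that a circle through e other than C uses only one bridge.
    Its part off that bridge, closed by an arc of C in place of the bridge, is a circle through e
    and the inner handle, hence is C itself; so that part lies in C. *)

Section Basics.
Variables (V E : finType) (ends : E -> V * V).

Local Notation src f := (ends f).1.
Local Notation tgt f := (ends f).2.
Local Notation incident := (incident ends).
Local Notation verts := (verts ends).
Local Notation deg := (deg ends).
Local Notation adjF := (adjF ends).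
Local Notation connectedE := (connectedE ends).
Local Notation isCircle := (isCircle ends).
Local Notation isPath := (isPath ends).
Implicit Types (F X Y Z P Q L R C A B : {set E}) (f g : E) (u v w x : V).

Definition joins f u w : bool :=
  ((src f == u) && (tgt f == w)) || ((src f == w) && (tgt f == u)).

Lemma joins_sym f u w : joins f u w = joins f w u.
Proof. by rewrite /joins orbC. Qed.

Lemma joins_ends f : joins f (src f) (tgt f).
Proof. by rewrite /joins !eqxx. Qed.

Lemma incident_joins f v : incident f v -> exists w, joins f v w.
Proof.
case/orP=> /eqP <-; first by exists (tgt f); apply: joins_ends.
by exists (src f); rewrite joins_sym joins_ends.
Qed.

Lemma joins_incident f u w v : joins f u w -> incident f v = (v == u) || (v == w).
Proof.
rewrite /Defs.incident ![v == _]eq_sym.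
by case/orP=> /andP[/eqP-> /eqP->] //; rewrite orbC.
Qed.

Lemma vertsP F v : reflect (exists2 f, f \in F & incident f v) (v \in verts F).
Proof. by rewrite inE; apply: (iffP exists_inP). Qed.

Lemma mem_verts F f v : f \in F -> incident f v -> v \in verts F.
Proof. by move=> fF fv; apply/vertsP; exists f. Qed.

Lemma joins_verts F f u w : f \in F -> joins f u w -> (u \in verts F) && (w \in verts F).
Proof.
by move=> fF J; rewrite !(mem_verts fF) // (joins_incident _ J) eqxx ?orbT.
Qed.

Lemma vertsU A B : verts (A :|: B) = verts A :|: verts B.
Proof.
apply/setP=> v; rewrite in_setU; apply/vertsP/orP.
  by case=> f; rewrite inE => /orP[] fA fv; [left|right]; apply: mem_verts fv.
by case=> /vertsP[f fA fv]; exists f; rewrite // inE fA ?orbT.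
Qed.

Lemma vertsS A B : A \subset B -> verts A \subset verts B.
Proof.
move=> /subsetP AB; apply/subsetP=> v /vertsP[f fA fv].
exact: mem_verts (AB _ fA) fv.
Qed.

Lemma verts1 f u w : joins f u w -> verts [set f] = [set u; w].
Proof.
move=> J; apply/setP=> v; rewrite in_set2 -(joins_incident v J).
by apply/vertsP/idP => [[g /set1P->]|fv] //; exists f; rewrite ?set11.
Qed.

Lemma deg_set1 f v : deg [set f] v = (src f == v) + (tgt f == v).
Proof.
have card1 (p : pred E) : #|[set g in [set f] | p g]| = p f.
  rewrite (cardsD1 f) !inE eqxx /= (_ : _ :\ f = set0) ?cards0 ?addn0 //.
  by apply/setP=> g; rewrite !inE; case: eqP.
by rewrite /Defs.deg !card1.
Qed.

Lemma degU A B v : [disjoint A & B] -> deg (A :|: B) v = deg A v + deg B v.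
Proof.
move=> dAB; rewrite /Defs.deg addnACA; congr (_ + _).
  rewrite -cardsUI [X in _ + #|pred_of_set X|](_ : _ = set0) ?cards0 ?addn0.
    by apply: eq_card => f; rewrite !inE andb_orl.
  apply/setP=> f; rewrite !inE; apply/negbTE/negP => /andP[/andP[fA _] /andP[fB _]].
  by move: dAB; rewrite disjoint_subset => /subsetP/(_ _ fA); rewrite inE fB.
rewrite -cardsUI [X in _ + #|pred_of_set X|](_ : _ = set0) ?cards0 ?addn0.
  by apply: eq_card => f; rewrite !inE andb_orl.
apply/setP=> f; rewrite !inE; apply/negbTE/negP => /andP[/andP[fA _] /andP[fB _]].
by move: dAB; rewrite disjoint_subset => /subsetP/(_ _ fA); rewrite inE fB.
Qed.

Lemma disjointDr A B : [disjoint A & B :\: A].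
Proof. by rewrite -setI_eq0; apply/eqP/setP=> f; rewrite !inE; case: (f \in A). Qed.

Lemma setUDr A B : A \subset B -> A :|: B :\: A = B.
Proof.
move=> /subsetP AB; apply/setP=> f; rewrite !inE.
by case: (boolP (f \in A)) => //= /AB ->.
Qed.

Lemma degD X Y v : X \subset Y -> deg Y v = deg X v + deg (Y :\: X) v.
Proof. by move=> XY; rewrite -degU ?disjointDr // setUDr. Qed.

Lemma deg_eq0 F v : (deg F v == 0) = (v \notin verts F).
Proof.
rewrite /Defs.deg addn_eq0 !cards_eq0; apply/andP/idP.
  case=> /eqP a /eqP b; apply/negP => /vertsP[f fF] /orP[] fv.
    by have := in_set0 f; rewrite -a inE fF fv.
  by have := in_set0 f; rewrite -b inE fF fv.
move=> nv; split; apply/eqP/setP=> f; rewrite !inE; apply/negbTE/negP=> /andP[fF fv];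
  by case/negP: nv; apply: mem_verts fF _; rewrite /Defs.incident fv ?orbT.
Qed.

Lemma deg0 F v : v \notin verts F -> deg F v = 0.
Proof. by rewrite -deg_eq0 => /eqP. Qed.

Lemma deg_gt0 F v : (0 < deg F v) = (v \in verts F).
Proof. by rewrite lt0n deg_eq0 negbK. Qed.

Lemma leq_deg X Y v : X \subset Y -> deg X v <= deg Y v.
Proof. by move=> XY; rewrite (degD v XY) leq_addr. Qed.

(** [Y :\: X] has degree 0 at [v]. This turns degree counts into the closure hypothesis of
    [connectedE_closed]. *)
Lemma deg_eq_edges X Y v f :
  X \subset Y -> deg X v = deg Y v -> f \in Y -> incident f v -> f \in X.
Proof.
move=> XY; rewrite (degD v XY) => /eqP; rewrite -[X in X == _]addn0 eqn_add2l eq_sym.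
rewrite deg_eq0 => nv fY fv; apply: contraNT nv => nf.
by apply: mem_verts fv; rewrite inE nf.
Qed.

Lemma adjFP F u w : reflect (exists2 f, f \in F & joins f u w) (adjF F u w).
Proof. exact: exists_inP. Qed.

Lemma adjF_sym F : symmetric (adjF F).
Proof. by move=> u w; apply/adjFP/adjFP=> -[f fF J]; exists f; rewrite // joins_sym. Qed.

Lemma connectF_sym F : connect_sym (adjF F).
Proof. exact/sym_connect_sym/adjF_sym. Qed.

Lemma connectFS A B u w : A \subset B -> connect (adjF A) u w -> connect (adjF B) u w.
Proof.
move=> /subsetP AB; apply: connect_sub => a b /adjFP[f fA J].
by apply: connect1; apply/adjFP; exists f; first exact: AB.
Qed.

(** The vertices of [X] are closed under adjacency in [Y], so by connectedness they include the
    source of every edge of [Y]. *)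
Lemma connectedE_closed X Y : X \subset Y -> connectedE Y -> X != set0 ->
  (forall v, v \in verts X -> forall f, f \in Y -> incident f v -> f \in X) -> X = Y.
Proof.
move=> XY [_ cY] /set0Pn[f0 f0X] clX; apply/eqP; rewrite eqEsubset XY /=.
have a0 : src f0 \in verts X by case/andP: (joins_verts f0X (joins_ends f0)).
have clV : closed (adjF Y) (mem (verts X)).
  apply: intro_closed; first exact: connectF_sym.
  move=> a b /adjFP[f fY J] aX.
  have fX : f \in X by apply: (clX a aX f fY); rewrite (joins_incident _ J) eqxx.
  by case/andP: (joins_verts fX J).
apply/subsetP=> f fY.
have sfY : src f \in verts Y by case/andP: (joins_verts fY (joins_ends f)).
have sfX : src f \in verts X.
  by rewrite -(closed_connect clV (cY _ _ (subsetP (vertsS XY) _ a0) sfY)).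
by apply: (clX _ sfX f fY); rewrite /Defs.incident eqxx.
Qed.

Lemma connectedE_U A B v : connectedE A -> connectedE B ->
  v \in verts A -> v \in verts B -> connectedE (A :|: B).
Proof.
move=> [A0 cA] [B0 cB] vA vB; split.
  by case/set0Pn: A0 => f fA; apply/set0Pn; exists f; rewrite inE fA.
have toA x : x \in verts (A :|: B) -> connect (adjF (A :|: B)) x v.
  rewrite vertsU in_setU => /orP[xA|xB].
    by apply: connectFS (cA _ _ xA vA); apply: subsetUl.
  by apply: connectFS (cB _ _ xB vB); apply: subsetUr.
move=> x y /toA xv /toA; rewrite connectF_sym; exact: connect_trans.
Qed.

Lemma odd_card F (p : pred E) :
  odd #|[set f in F | p f]| = \big[addb/false]_(f in F) p f.
Proof.
rewrite -sum1_card (big_morph odd oddD (erefl _)) [RHS](bigID p) /=.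
rewrite [X in _ = _ (+) X]big1 ?addbF; last by move=> f /andP[_ /negbTE].
by apply: eq_big => f; rewrite !inE // => /andP[_ ->].
Qed.

Lemma xor_pick (z : V -> bool) u : \big[addb/false]_v (z v && (u == v)) = z u.
Proof.
by rewrite (bigD1 u) //= eqxx andbT big1 ?addbF // => v; rewrite eq_sym => /negbTE->; rewrite andbF.
Qed.

Lemma xor_pick2 (z : V -> bool) u w :
  \big[addb/false]_v (z v && ((v == u) (+) (v == w))) = z u (+) z w.
Proof.
rewrite -(xor_pick z u) -(xor_pick z w) -big_split /=; apply: eq_bigr => v _.
by rewrite ![v == _]eq_sym; case: (z v).
Qed.

(** Exchanging the sums counts each edge at both ends. The weight [z] will be the indicator of a
    component, a switching function, or constant for plain parity. *)
Lemma handshake F (z : V -> bool) :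
  \big[addb/false]_(f in F) (z (src f) (+) z (tgt f)) =
  \big[addb/false]_v (z v && odd (deg F v)).
Proof.
under [RHS]eq_bigr => v _ do rewrite /Defs.deg oddD !odd_card -big_split /= big_distrr /=.
rewrite exchange_big /=; apply: eq_bigr => f _.
rewrite -(xor_pick z (src f)) -(xor_pick z (tgt f)) -big_split /=; apply: eq_bigr => v _.
by case: (z v).
Qed.

Lemma path_sym P u w : isPath P u w -> isPath P w u.
Proof.
case=> nuw cP uP wP [du dw dv]; split=> //; first by rewrite eq_sym.
by split=> // v vP vw vu; apply: dv.
Qed.

Lemma path_odd P u w v : isPath P u w -> odd (deg P v) = (v == u) (+) (v == w).
Proof.
case=> nuw cP uP wP [du dw dv].
case: (eqVneq v u) => [->|vu]; first by rewrite du (negbTE nuw).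
case: (eqVneq v w) => [->|vw]; first by rewrite dw.
case: (boolP (v \in verts P)) => vP; first by rewrite dv.
by rewrite deg0.
Qed.

Lemma circle_odd C v : isCircle C -> odd (deg C v) = false.
Proof.
by move=> [_ d]; case: (boolP (v \in verts C)) => vC; [rewrite d | rewrite deg0].
Qed.

Lemma path_handshake P u w (z : V -> bool) : isPath P u w ->
  \big[addb/false]_(f in P) (z (src f) (+) z (tgt f)) = z u (+) z w.
Proof.
move=> pP; rewrite handshake -[RHS]xor_pick2.
by apply: eq_bigr => v _; rewrite (path_odd v pP).
Qed.

Lemma circle_handshake C (z : V -> bool) : isCircle C ->
  \big[addb/false]_(f in C) (z (src f) (+) z (tgt f)) = false.
Proof. by move=> cC; rewrite handshake big1 // => v _; rewrite circle_odd // andbF. Qed.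

(* A component of X avoiding both u and w would be closed in Y; by parity of the
   degree sum a component of X contains u iff it contains w. *)
Lemma path_of_deg X Y u w : X \subset Y -> connectedE Y -> u != w ->
  deg X u = 1 -> deg X w = 1 ->
  (forall v, v \in verts X -> v != u -> v != w -> deg X v = 2 /\ deg Y v = 2) ->
  isPath X u w.
Proof.
move=> XY cY nuw du dw dv.
have uX : u \in verts X by rewrite -deg_gt0 du.
have wX : w \in verts X by rewrite -deg_gt0 dw.
have dodd v : odd (deg X v) = (v == u) (+) (v == w).
  case: (eqVneq v u) => [->|vu]; first by rewrite du (negbTE nuw).
  case: (eqVneq v w) => [->|vw]; first by rewrite dw.
  case: (boolP (v \in verts X)) => vX; last by rewrite deg0.
  by have [-> _] := dv _ vX vu vw.
have Xn0 : X != set0 by case/vertsP: uX => f fX _; apply/set0Pn; exists f.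
have toU a : a \in verts X -> connect (adjF X) a u.
  move=> aX; pose K v := connect (adjF X) a v.
  have KX f : f \in X -> K (src f) = K (tgt f).
    move=> fX; have st : adjF X (src f) (tgt f) by apply/adjFP; exists f; rewrite ?joins_ends.
    apply/idP/idP => h; apply: connect_trans h _; first exact: connect1.
    by rewrite connectF_sym; apply: connect1.
  have : K u (+) K w = false.
    rewrite -xor_pick2; under eq_bigr do rewrite -dodd.
    by rewrite -handshake big1 // => f fX; rewrite KX // addbb.
  apply: contraFT => nKu; have -> : K u = false by exact/negbTE.
  rewrite /=; apply: contraT => nKw.
  pose X' := [set f in X | K (src f)].
  have X'X : X' \subset X by apply/subsetP=> f; rewrite inE => /andP[].
  have inX' f v : f \in X -> incident f v -> K v -> f \in X'.
    move=> fX /orP[] /eqP <- Kv; rewrite inE fX //=; by rewrite KX.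
  have KX' v : v \in verts X' -> K v.
    by case/vertsP=> f; rewrite inE => /andP[fX Ks] /orP[] /eqP<- //; rewrite -KX.
  have Ka : K a by apply: connect0.
  have X'Y : X' = Y.
    apply: connectedE_closed => //; first exact: subset_trans XY.
      by case/vertsP: aX => f fX fa; apply/set0Pn; exists f; apply: inX' fa Ka.
    move=> v vX' f fY fv; have Kv := KX' _ vX'.
    have vX := subsetP (vertsS X'X) _ vX'.
    have vu : v != u by apply: contraNneq nKu => <-.
    have vw : v != w by apply: contraNneq nKw => <-.
    have [d1 d2] := dv _ vX vu vw.
    by apply: (inX' f v) => //; apply: deg_eq_edges XY _ fY fv; rewrite d1 d2.
  by case/negP: nKu; apply: KX'; rewrite X'Y; apply: (subsetP (vertsS XY)).
split=> //; last by split=> // v vX vu vw; case: (dv _ vX vu vw).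
split=> // x y /toU xu /toU; rewrite connectF_sym; exact: connect_trans.
Qed.

Lemma path1 f u w : joins f u w -> u != w -> isPath [set f] u w.
Proof.
move=> J nuw; have nwu : w != u by rewrite eq_sym.
have V1 := verts1 J.
have dE v : deg [set f] v = (v == u) + (v == w).
  rewrite deg_set1 ![v == _]eq_sym.
  by case/orP: J => /andP[/eqP-> /eqP->] //; rewrite addnC.
apply: (@path_of_deg _ [set f]) => //.
- split; first by apply/set0Pn; exists f; rewrite set11.
  have uw : connect (adjF [set f]) u w.
    by apply: connect1; apply/adjFP; exists f; rewrite ?set11.
  have wu : connect (adjF [set f]) w u by rewrite connectF_sym.
  by move=> x y; rewrite V1 => /set2P[]-> /set2P[]->.
- by rewrite dE eqxx (negbTE nuw).
- by rewrite dE eqxx (negbTE nwu).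
- by move=> v; rewrite V1 => /set2P[]->; rewrite eqxx.
Qed.

(** A loop adds 2 to a degree that is at most 2 on a path, so it would be a whole component, with
    one vertex for two distinct ends. *)
Lemma path_noloop P u w f : isPath P u w -> f \in P -> src f != tgt f.
Proof.
move=> [nuw cP uP wP [du dw dv]] fP; apply/eqP => st.
have fsub : [set f] \subset P by rewrite sub1set.
have sP : src f \in verts P by apply: mem_verts fP _; rewrite /Defs.incident eqxx.
have d2 : 2 <= deg P (src f).
  by apply: leq_trans (leq_deg _ fsub); rewrite deg_set1 -st eqxx.
have Y1 : [set f] = P.
  apply: connectedE_closed => //; first by apply/set0Pn; exists f; rewrite set11.
  move=> v; rewrite (verts1 (joins_ends f)) -st => vs g gP gv.
  have {}vs : v = src f by case/set2P: vs.
  rewrite vs in gv.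
  apply: (deg_eq_edges fsub) gP gv; rewrite deg_set1 -st eqxx.
  case: (eqVneq (src f) u) => [e|su]; first by rewrite e du in d2.
  case: (eqVneq (src f) w) => [e|sw]; first by rewrite e dw in d2.
  by rewrite dv.
move: uP wP; rewrite -Y1 (verts1 (joins_ends f)) -st setUid => /set1P a /set1P b.
by rewrite a b eqxx in nuw.
Qed.

Lemma path_neq P u w : isPath P u w -> u != w. Proof. by case. Qed.
Lemma path_l P u w : isPath P u w -> u \in verts P. Proof. by case. Qed.
Lemma path_r P u w : isPath P u w -> w \in verts P. Proof. by case. Qed.
Lemma path_conn P u w : isPath P u w -> connectedE P. Proof. by case. Qed.
Lemma path_degl P u w : isPath P u w -> deg P u = 1. Proof. by case=> _ _ _ _ []. Qed.
Lemma path_degr P u w : isPath P u w -> deg P w = 1. Proof. by case=> _ _ _ _ []. Qed.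
Lemma path_degi P u w v : isPath P u w -> v \in verts P -> v != u -> v != w -> deg P v = 2.
Proof. by case=> _ _ _ _ [_ _]; apply. Qed.

Lemma path_n0 P u w : isPath P u w -> exists f, f \in P.
Proof. by case=> _ [/set0Pn]. Qed.

(** Edge-disjointness comes for free: a common edge would have both ends at [v] and be a loop. *)
Lemma path_cat P Q u v w : isPath P u v -> isPath Q v w ->
  (forall x, x \in verts P -> x \in verts Q -> x = v) ->
  isPath (P :|: Q) u w /\ [disjoint P & Q].
Proof.
move=> pP pQ I.
have dPQ : [disjoint P & Q].
  rewrite -setI_eq0; apply/eqP/setP => f; rewrite inE in_set0.
  apply/negbTE/negP => /andP[fP fQ].
  have/andP[a b] := joins_verts fP (joins_ends f).
  have/andP[c d] := joins_verts fQ (joins_ends f).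
  by have := path_noloop pP fP; rewrite (I _ a c) (I _ b d) eqxx.
split=> //; have nuv := path_neq pP; have nvw := path_neq pQ.
have uQ : u \notin verts Q.
  by apply: contraNN nuv => uQ; rewrite (I _ (path_l pP) uQ).
have wP : w \notin verts P.
  by apply: contraNN nvw => wP; rewrite (I _ wP (path_r pQ)).
split; first by apply: contraNneq uQ => ->; apply: path_r pQ.
- exact: connectedE_U (path_conn pP) (path_conn pQ) (path_r pP) (path_l pQ).
- by rewrite vertsU in_setU (path_l pP).
- by rewrite vertsU in_setU (path_r pQ) orbT.
split; rewrite ?degU //.
- by rewrite (path_degl pP) deg0.
- by rewrite (path_degr pQ) deg0.
move=> x xPQ xu xw; rewrite degU //.
case: (eqVneq x v) => [->|xv]; first by rewrite (path_degr pP) (path_degl pQ).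
move: xPQ; rewrite vertsU in_setU; case: (boolP (x \in verts P)) => xP /=.
  move=> _; rewrite (path_degi pP) // deg0 //; apply: contraNN xv => xQ; exact/eqP/I.
by move=> xQ; rewrite (deg0 xP) (path_degi pQ).
Qed.

(** Disjointness must be assumed here: both paths could be the same single edge joining [u] and
    [w]. *)
Lemma circle_of_paths P Q u w : isPath P u w -> isPath Q u w -> [disjoint P & Q] ->
  (forall x, x \in verts P -> x \in verts Q -> x = u \/ x = w) -> isCircle (P :|: Q).
Proof.
move=> pP pQ dPQ I; split.
  exact: connectedE_U (path_conn pP) (path_conn pQ) (path_l pP) (path_l pQ).
move=> x; rewrite vertsU in_setU degU // => xPQ.
case: (eqVneq x u) => [->|xu]; first by rewrite (path_degl pP) (path_degl pQ).
case: (eqVneq x w) => [->|xw]; first by rewrite (path_degr pP) (path_degr pQ).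
case: (boolP (x \in verts P)) xPQ => xP /=.
  move=> _; rewrite (path_degi pP) // deg0 //; apply/negP => xQ.
  by case: (I _ xP xQ) => /eqP; apply/negP.
by move=> xQ; rewrite (deg0 xP) (path_degi pQ).
Qed.

(** Cuts the walk at its first vertex in [T]. The last conclusion serves the induction: with [uniq]
    it keeps the prepended vertex off the path already built. *)
Lemma first_path_aux F (T : {set V}) s p :
  path (adjF F) s p -> uniq (s :: p) -> s \notin T -> last s p \in T ->
  exists P t, [/\ P \subset F, isPath P s t, t \in T,
    forall x, x \in verts P -> x \in T -> x = t &
    {subset verts P <= s :: p}].
Proof.
elim: p s => [|v p IH] s /=; first by move=> _ _ /negbTE->.
case/andP=> /adjFP[f fF J] pth /andP[sp /andP[vp up]] sT lT.
have nsv : s != v by apply: contraNneq sp => ->; rewrite mem_head.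
case: (boolP (v \in T)) => vT.
  exists [set f], v; split=> //; first by rewrite sub1set.
  - exact: path1.
  - by move=> x; rewrite (verts1 J) => /set2P[]-> //; rewrite (negbTE sT).
  - by move=> x; rewrite (verts1 J) in_set2 !inE => /orP[]->; rewrite ?orbT.
have [|P [t [PF pP tT PT Pp]]] := IH v pth _ vT lT; first by rewrite /= vp.
have sP : s \notin verts P by apply: contraNN sp => /Pp.
exists ([set f] :|: P), t; split=> //; first by rewrite subUset sub1set fF.
- apply: (proj1 (path_cat (path1 J nsv) pP _)) => x.
  by rewrite (verts1 J) => /set2P[]-> //; rewrite (negbTE sP).
- move=> x; rewrite vertsU (verts1 J) !in_setU !in_set1 -orbA => /or3P[/eqP->|/eqP->|].
  + by rewrite (negbTE sT).
  + by rewrite (negbTE vT).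
  + exact: PT.
- move=> x; rewrite vertsU (verts1 J) !in_setU !in_set1 => /orP[/orP[]/eqP->|].
  + by rewrite mem_head.
  + by rewrite !inE eqxx orbT.
  + by move/Pp => xvp; rewrite in_cons xvp orbT.
Qed.

Lemma first_path F (T : {set V}) s t : connect (adjF F) s t -> s \notin T -> t \in T ->
  exists P t', [/\ P \subset F, isPath P s t', t' \in T &
    forall x, x \in verts P -> x \in T -> x = t'].
Proof.
case/connectP=> p pth -> sT lT.
case/shortenP: pth lT => p' pth' up' _ lT.
by have [P [t' []]] := first_path_aux pth' up' sT lT; exists P, t'.
Qed.

Lemma connect_path F s t : connect (adjF F) s t -> s != t ->
  exists2 P : {set E}, P \subset F & isPath P s t.
Proof.
move=> cst nst; have sT : s \notin [set t] by rewrite inE.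
by have [P [t' [PF pP /set1P<- _]]] := first_path cst sT (set11 t); exists P.
Qed.

(** Degrees in [P] are sums of degrees in [L] and in [P :\: L]; the known values 1 and 2 at each
    vertex determine the rest, without any order on the path. *)
Lemma path_suffix P L u p w : L \subset P -> isPath P u w -> isPath L u p -> p != w ->
  isPath (P :\: L) p w /\ (forall x, x \in verts L -> x \in verts (P :\: L) -> x = p).
Proof.
move=> LP pP pL npw; have D v := degD v LP.
have wL : w \notin verts L.
  apply/negP => wL; have := leq_deg w LP; rewrite (path_degr pP).
  by rewrite (path_degi pL) // eq_sym //; exact: path_neq pP.
have uD : deg (P :\: L) u = 0 by have := D u; rewrite (path_degl pP) (path_degl pL); lia.
have pP2 : deg P p = 2.
  apply: (path_degi pP) => //; first exact: (subsetP (vertsS LP)) _ (path_r pL).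
  by rewrite eq_sym; exact: path_neq pL.
have pD : deg (P :\: L) p = 1 by have := D p; rewrite pP2 (path_degr pL); lia.
have wD : deg (P :\: L) w = 1 by have := D w; rewrite (path_degr pP) (deg0 wL).
split.
  apply: (@path_of_deg _ P) => //; [exact: subsetDl | exact: path_conn pP|].
  move=> v vX vp vw.
  have vu : v != u by apply: contraTneq vX => ->; rewrite -deg_eq0 uD.
  have vP := subsetP (vertsS (subsetDl _ _)) _ vX.
  rewrite (path_degi pP vP vu vw); split=> //.
  have := D v; rewrite (path_degi pP vP vu vw).
  case: (boolP (v \in verts L)) => vL; last by rewrite (deg0 vL).
  by rewrite (path_degi pL vL vu vp); move: vX; rewrite -deg_gt0; lia.
move=> x xL xR; apply/eqP; apply: contraTT xR => xp.
have xP := subsetP (vertsS LP) _ xL; rewrite -deg_eq0.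
case: (eqVneq x u) => [->|xu]; first by rewrite uD.
case: (eqVneq x w) => [xw|xw]; first by rewrite -xw xL in wL.
by have := D x; rewrite (path_degi pP xP xu xw) (path_degi pL xL xu xp); lia.
Qed.

Lemma subpath_eq P L u w : L \subset P -> isPath P u w -> isPath L u w -> L = P.
Proof.
move=> LP pP pL; apply: connectedE_closed => //; first exact: path_conn pP.
  by have [f fL] := path_n0 pL; apply/set0Pn; exists f.
move=> v vL f fP fv; apply: (deg_eq_edges LP) fP fv.
case: (eqVneq v u) => [->|vu]; first by rewrite (path_degl pP) (path_degl pL).
case: (eqVneq v w) => [->|vw]; first by rewrite (path_degr pP) (path_degr pL).
by rewrite (path_degi pL) // (path_degi pP) // (subsetP (vertsS LP)).
Qed.

Lemma path_split P u w p : isPath P u w -> p \in verts P -> p != u -> p != w ->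
  exists L R, [/\ P = L :|: R, isPath L u p, isPath R p w &
    forall x, x \in verts L -> x \in verts R -> x = p].
Proof.
move=> pP pv pu pw.
have [_ cP] := path_conn pP.
have up : u != p by rewrite eq_sym.
have [L LP pL] := connect_path (cP _ _ (path_l pP) pv) up.
have [pR I] := path_suffix LP pP pL pw.
by exists L, (P :\: L); rewrite setUDr.
Qed.

(** Degree 2 on all of [C] leaves degree 1 at the ends of [Q] and 0 at its inner vertices. *)
Lemma circle_compl C Q u w : isCircle C -> Q \subset C -> isPath Q u w ->
  isPath (C :\: Q) u w /\
  (forall x, x \in verts Q -> x \in verts (C :\: Q) -> x = u \/ x = w).
Proof.
move=> [cC d] QC pQ; have D v := degD v QC.
have inC := subsetP (vertsS QC).
have uD : deg (C :\: Q) u = 1.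
  by have := D u; rewrite (path_degl pQ) d ?inC ?(path_l pQ) //; lia.
have wD : deg (C :\: Q) w = 1.
  by have := D w; rewrite (path_degr pQ) d ?inC ?(path_r pQ) //; lia.
have iD v : v \in verts Q -> v != u -> v != w -> deg (C :\: Q) v = 0.
  by move=> vQ vu vw; have := D v; rewrite (path_degi pQ) // d ?inC //; lia.
split.
  apply: (@path_of_deg _ C) => //; [exact: subsetDl | exact: path_neq pQ|].
  move=> v vX vu vw.
  have vC := subsetP (vertsS (subsetDl _ _)) _ vX.
  have vQ : v \notin verts Q.
    by apply: contraTN vX => vQ; rewrite -deg_eq0 iD.
  by rewrite d //; split=> //; have := D v; rewrite d // (deg0 vQ).
move=> x xQ xD.
case: (eqVneq x u) => [|xu]; first by left.
case: (eqVneq x w) => [|xw]; first by right.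
by move: xD; rewrite -deg_gt0 iD.
Qed.

(** At its vertices [Z] has even positive degree at most 2, so it exhausts the degree of [C]
    there. *)
Lemma even_sub_circle C Z : isCircle C -> Z \subset C -> Z != set0 ->
  (forall v, ~~ odd (deg Z v)) -> Z = C.
Proof.
move=> [cC d] ZC Z0 ev; apply: connectedE_closed => // v vZ f fC fv.
apply: (deg_eq_edges ZC) fC fv.
have := leq_deg v ZC; rewrite d ?(subsetP (vertsS ZC)) //.
by move: (ev v); rewrite -deg_gt0 in vZ; case: (deg Z v) vZ => [|[|[|]]].
Qed.

(** The symmetric difference of two paths with the same ends has even degrees, so inside a circle it
    is empty or everything. *)
Lemma circle_paths C Q A u w : isCircle C -> Q \subset C -> A \subset C ->
  isPath Q u w -> isPath A u w -> Q = A \/ Q = C :\: A.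
Proof.
move=> cC QC AC pQ pA; pose Z := (Q :\: A) :|: (A :\: Q).
have dZ : [disjoint Q :\: A & A :\: Q].
  by rewrite -setI_eq0; apply/eqP/setP=> f; rewrite !inE; case: (f \in A); rewrite ?andbF.
have ZC : Z \subset C by rewrite subUset !(subset_trans (subsetDl _ _)).
have DI X Y v : deg X v = deg (X :&: Y) v + deg (X :\: Y) v.
  by rewrite (degD v (subsetIl X Y)); congr (_ + deg _ v); apply/setP=> f; rewrite !inE;
     case: (f \in X); rewrite ?andbF ?andbT.
have ev v : ~~ odd (deg Z v).
  have oQ := path_odd v pQ; have oA := path_odd v pA.
  rewrite (DI Q A) oddD in oQ; rewrite (DI A Q) setIC oddD in oA.
  rewrite /Z degU // oddD; move: oQ oA.
  by case: (odd (deg (Q :&: A) v)); case: (odd _); case: (odd _); rewrite //= => <-.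
have [Z0|Zn0] := eqVneq Z set0.
  left; apply/setP=> f; have := in_set0 f; rewrite -Z0 !inE.
  by case: (f \in Q); case: (f \in A).
right; have ZE := even_sub_circle cC ZC Zn0 ev; rewrite -ZE.
have dQA : [disjoint Q & A].
  rewrite -setI_eq0; apply/eqP/setP=> f; rewrite !inE; apply/negbTE/negP=> /andP[fQ fA].
  by have := subsetP QC _ fQ; rewrite -ZE !inE fQ fA.
apply/setP=> f; rewrite !inE; case: (boolP (f \in Q)) => fQ /=.
  by rewrite (disjointFr dQA fQ).
by case: (f \in A).
Qed.

(** A circle passes a separating pair [u], [w] only twice. This is applied with [X1] and [X2] the
    traces of a circle on the two sides of such a pair. *)
Lemma circle_split C X1 X2 u w : isCircle C -> X1 :|: X2 = C -> [disjoint X1 & X2] ->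
  X1 != set0 -> X2 != set0 -> u != w ->
  (forall x, x \in verts X1 -> x \in verts X2 -> x = u \/ x = w) ->
  isPath X1 u w /\ isPath X2 u w.
Proof.
move=> cC XC dX; have [cC' d] := cC.
wlog uX : u w / (u \in verts X1) && (u \in verts X2).
  move=> W n1 n2 nuw I.
  (* Without a common vertex [X1] would be closed in the connected [C], hence equal to it. *)
  have/exists_inP[u' uX1 uX2] : [exists u' in verts X1, u' \in verts X2].
    apply: contraT => /exists_inPn nX.
    have X1C : X1 = C.
      apply: connectedE_closed => //; first by rewrite -XC subsetUl.
      move=> v vX1 f; rewrite -XC inE => /orP[//|fX2] fv.
      by have := nX _ vX1; rewrite (mem_verts fX2 fv).
    move: n2 dX; rewrite -XC in X1C; case/set0Pn=> f fX2; rewrite disjoint_sym.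
    by move/(fun h => disjointFr h fX2); rewrite X1C inE fX2 orbT.
  case: (I _ uX1 uX2) => e; subst u'; first by apply: W; rewrite ?uX1.
  have I' x : x \in verts X1 -> x \in verts X2 -> x = w \/ x = u.
    by move=> x1 x2; case: (I _ x1 x2); [right|left].
  have [||p1 p2] := W w u _ n1 n2 _ I'; rewrite ?uX1 1?eq_sym //.
  by split; apply: path_sym.
move=> n1 n2 nuw I; have {uX} [uX1 uX2] := andP uX.
have D v : deg C v = deg X1 v + deg X2 v by rewrite -XC degU.
have sX1 : X1 \subset C by rewrite -XC subsetUl.
have sX2 : X2 \subset C by rewrite -XC subsetUr.
have uC : u \in verts C by apply: (subsetP (vertsS sX1)).
have du : deg X1 u = 1 /\ deg X2 u = 1.
  by move: uX1 uX2 (D u); rewrite -!deg_gt0 d //; lia.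
have dv X Y v : X :|: Y = C -> [disjoint X & Y] ->
  (forall x, x \in verts X -> x \in verts Y -> x = u \/ x = w) ->
  v \in verts X -> v != u -> v != w -> deg X v = 2 /\ deg C v = 2.
  move=> XYC dXY J vX vu vw.
  have vY : v \notin verts Y.
    by apply/negP => vY; case: (J _ vX vY) => /eqP; rewrite ?(negbTE vu) ?(negbTE vw).
  have d2 : deg C v = 2 by apply: d; rewrite -XYC vertsU in_setU vX.
  by split=> //; rewrite -d2 -XYC degU // (deg0 vY) addn0.
have ow X Y : X :|: Y = C -> [disjoint X & Y] ->
  (forall x, x \in verts X -> x \in verts Y -> x = u \/ x = w) ->
  deg X u = 1 -> deg X w = 1.
  move=> XYC dXY J dXu.
  have XC' : X \subset C by rewrite -XYC subsetUl.
  (* The number of vertices of odd degree is even; [u] is one of them and only [w] can be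
     another. *)
  have := handshake X (fun=> true); rewrite big1 //= => ev.
  have : odd (deg X w).
    apply: contraT => nw; move: ev; rewrite (bigD1 u) //= dXu big1 // => v vu.
    have [->|vw] := eqVneq v w; first by rewrite (negbTE nw).
    case: (boolP (v \in verts X)) => vX; last by rewrite deg0.
    by have [-> _] := dv _ _ _ XYC dXY J vX vu vw.
  have := leq_deg w XC'; case: (boolP (w \in verts C)) => wC.
    by rewrite d //; case: (deg X w) => [|[|[|]]].
  by rewrite (deg0 wC) leqn0 => /eqP->.
have dX' : [disjoint X2 & X1] by rewrite disjoint_sym.
have XC' : X2 :|: X1 = C by rewrite setUC.
have I' x : x \in verts X2 -> x \in verts X1 -> x = u \/ x = w by move=> a b; apply: I.
have [du1 du2] := du.
split; apply: (@path_of_deg _ C) => //.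
- exact: ow XC dX I du1.
- by move=> v; apply: dv XC dX I.
- exact: ow XC' dX' I' du2.
- by move=> v; apply: dv XC' dX' I'.
Qed.

End Basics.

(** * Bridges, blocks and ear decomposition *)

Section Bridges.
Variables (V E : finType) (ends : E -> V * V).

Local Notation src f := (ends f).1.
Local Notation tgt f := (ends f).2.
Local Notation incident := (incident ends).
Local Notation joins := (joins ends).
Local Notation verts := (verts ends).
Local Notation adjF := (adjF ends).
Local Notation adjOff := (adjOff ends).
Local Notation isCircle := (isCircle ends).
Local Notation isPath := (isPath ends).
Local Notation isComp := (isComp ends).
Local Notation isBridge := (isBridge ends).
Local Notation compEdges := (compEdges ends).
Local Notation att := (att ends).
Implicit Types (F X Y Z P Q L R C A B : {set E}) (f g : E) (u v w x : V) (D T : {set V}).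

Definition comp C v : {set V} := [set w | (w \notin verts C) && connect (adjOff C) v w].

Lemma comp_isComp C v : v \notin verts C -> isComp C (comp C v).
Proof. by move=> vC; exists v. Qed.

Lemma adjOff_sym C : connect_sym (adjOff C).
Proof.
by apply: sym_connect_sym => u w; rewrite /Defs.adjOff andbCA adjF_sym.
Qed.

Lemma adjOffP C f u w : joins f u w -> u \notin verts C -> w \notin verts C -> adjOff C u w.
Proof. by move=> J uC wC; rewrite /Defs.adjOff uC wC; apply/adjFP; exists f. Qed.

Lemma compP C v w : reflect (w \notin verts C /\ connect (adjOff C) v w) (w \in comp C v).
Proof. by rewrite [X in reflect _ X]in_set; apply: andP. Qed.

Lemma comp_eq C v w : w \in comp C v -> comp C v = comp C w.
Proof.
move=> /compP[wC vw]; apply/setP=> x; apply/compP/compP => -[xC c]; split=> //.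
  by apply: connect_trans c; rewrite adjOff_sym.
exact: connect_trans c.
Qed.

Lemma isComp_eq C D v : isComp C D -> v \in D -> D = comp C v.
Proof. by case=> w [wC ->] vD; apply: comp_eq. Qed.

Lemma comp_off C D v : isComp C D -> v \in D -> v \notin verts C.
Proof. by case=> w [wC ->]; rewrite in_set => /andP[]. Qed.

Lemma comp_joins C D f u w :
  isComp C D -> u \in D -> joins f u w -> w \notin verts C -> w \in D.
Proof.
move=> cD uD J wC; have uC := comp_off cD uD.
rewrite (isComp_eq cD uD); apply/compP; split=> //.
by apply: connect1; apply: adjOffP J _ _.
Qed.

Lemma mem_comp C v : v \notin verts C -> v \in comp C v.
Proof. by move=> vC; apply/compP. Qed.

Lemma compEdgesP D f : reflect (exists2 v, v \in D & incident f v) (f \in compEdges D).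
Proof.
rewrite inE; apply: (iffP orP).
  by case=> h; [exists (src f)|exists (tgt f)]; rewrite // /Defs.incident eqxx ?orbT.
by case=> v vD /orP[] /eqP e; rewrite e; [left|right].
Qed.

Lemma comp_incident C D f v :
  isComp C D -> f \in compEdges D -> incident f v -> v \notin verts C -> v \in D.
Proof.
move=> cD /compEdgesP[u uD fu] fv vC.
have [w J] := incident_joins fu.
by move: fv; rewrite (joins_incident _ J) => /orP[]/eqP e; subst v => //; apply: comp_joins J vC.
Qed.

(** Bridges partition the non-loop edges off [C], so a bridge can be named by any of its edges and
    quantifying over bridges becomes a finite search. On edges of [C] the singleton is a junk
    value. *)
Definition bridgeOf C f : {set E} :=
  if src f \notin verts C then compEdges (comp C (src f)) else
  if tgt f \notin verts C then compEdges (comp C (tgt f)) else [set f].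

Lemma bridgeOf_off C f v : incident f v -> v \notin verts C ->
  bridgeOf C f = compEdges (comp C v).
Proof.
move=> fv vC; rewrite /bridgeOf.
have key u : incident f u -> u \notin verts C -> compEdges (comp C u) = compEdges (comp C v).
  move=> fu uC; congr compEdges.
  rewrite -(isComp_eq (comp_isComp vC)) //.
  by apply: (comp_incident (comp_isComp vC)) fu uC; apply/compEdgesP; exists v; rewrite ?mem_comp.
case: ifP => [/key->//|sC]; first by rewrite /Defs.incident eqxx.
case: ifP => [/key->//|tC]; first by rewrite /Defs.incident eqxx orbT.
by case/orP: fv vC => /eqP<-; rewrite ?sC ?tC.
Qed.

Lemma bridge_notin C D F f : isBridge C D F -> f \in F -> f \notin C.
Proof.
case=> [[_ [c [[cC _ _ _] ->]]] /set1P->//|[cD ->] /compEdgesP[v vD fv]].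
by apply: contraNN (comp_off cD vD) => fC; apply: mem_verts fC fv.
Qed.

Lemma bridge_eq C D F f : isBridge C D F -> f \in F -> F = bridgeOf C f.
Proof.
case=> [[_ [c [[cC sC tC _] ->]]] /set1P->|[cD ->] /compEdgesP[v vD fv]].
  by rewrite /bridgeOf sC tC.
by rewrite (bridgeOf_off fv) ?(comp_off cD vD) // -(isComp_eq cD vD).
Qed.

Lemma bridgeOf_bridge C f : f \notin C -> src f != tgt f ->
  f \in bridgeOf C f /\ exists D, isBridge C D (bridgeOf C f).
Proof.
move=> fC st; rewrite /bridgeOf; case: ifP => sC.
  split; first by apply/compEdgesP; exists (src f); rewrite ?mem_comp ?/Defs.incident ?eqxx.
  by exists (comp C (src f)); right; split=> //; apply: comp_isComp.
case: ifP => tC.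
  split; first by apply/compEdgesP; exists (tgt f); rewrite ?mem_comp ?/Defs.incident ?eqxx ?orbT.
  by exists (comp C (tgt f)); right; split=> //; apply: comp_isComp.
rewrite set11; split=> //; exists set0; left; split=> //; exists f; split=> //.
by split=> //; apply/negbNE; rewrite ?sC ?tC.
Qed.

Lemma bridge_eq_vertex C D1 F1 D2 F2 v : isBridge C D1 F1 -> isBridge C D2 F2 ->
  v \in verts F1 -> v \in verts F2 -> v \notin verts C -> F1 = F2.
Proof.
move=> b1 b2 /vertsP[f fF fv] /vertsP[g gF gv] vC.
by rewrite (bridge_eq b1 fF) (bridge_eq b2 gF) (bridgeOf_off fv vC) (bridgeOf_off gv vC).
Qed.

Hypothesis blk : isBlock ends.

(** The vertex of a loop would separate the loop from the remaining edges; [g] witnesses that there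
    are some. *)
Lemma block_noloop f g : g != f -> src f != tgt f.
Proof.
move=> gf; apply/eqP => st; apply: (proj2 blk (src f)); exists [set f], (~: [set f]); split.
- by apply/set0Pn; exists f; rewrite set11.
- by apply/set0Pn; exists g; rewrite !inE.
- exact: setICr.
- exact: setUCr.
by move=> x; rewrite (verts1 (joins_ends ends f)) -st setUid => /set1P.
Qed.

Lemma comp_edge C D : C != set0 -> isComp C D -> exists f, f \in compEdges D.
Proof.
case/set0Pn=> c cC [v [vC DE]].
have vD : v \in D by rewrite DE in_set vC connect0.
have sC : src c \in verts C by case/andP: (joins_verts cC (joins_ends ends c)).
have /connectP[[|w p] /=] := proj2 (proj1 blk) v (src c).
  by move=> _ e; rewrite -e sC in vC.
case/andP=> /adjFP[f _ J] _ _; exists f; apply/compEdgesP; exists v => //.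
by rewrite (joins_incident _ J) eqxx.
Qed.

(** A single attachment would be a cutpoint between the edges at [D] and all others. *)
Lemma comp_att_gt1 C D : C != set0 -> isComp C D -> 1 < #|att C (compEdges D)|.
Proof.
move=> C0 cD; rewrite ltnNge; apply/negP => le1.
have [v attv] : exists v, forall x, x \in att C (compEdges D) -> x = v.
  (* Without attachments any vertex of the graph serves as the cutpoint. *)
  have [a0|[v vA]] := set_0Vmem (att C (compEdges D)).
    by have [[[v _] _] _] := blk; exists v => x; rewrite a0 in_set0.
  exists v => x xA; apply/eqP; apply: contraTT le1 => xv; rewrite -ltnNge.
  have sub : [set x; v] \subset att C (compEdges D).
    by apply/subsetP=> y /set2P[]->.
  by apply: leq_trans (subset_leq_card sub); rewrite cards2 xv.
apply: (proj2 blk v); exists (compEdges D), (~: compEdges D); split.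
- by have [f fF] := comp_edge C0 cD; apply/set0Pn; exists f.
- case/set0Pn: C0 => c cC; apply/set0Pn; exists c; rewrite in_setC.
  by apply: contraTN cC => cF; apply: (bridge_notin (D:=D) (or_intror (conj cD erefl))).
- exact: setICr.
- exact: setUCr.
move=> x xF xN; apply: attv; rewrite in_setI xF andbT.
apply: contraTT xN => xC; apply/negP => /vertsP[f]; rewrite in_setC => /negP nf fx; apply: nf.
case/vertsP: xF => g gF gx; apply/compEdgesP; exists x => //.
exact: comp_incident cD gF gx xC.
Qed.

Lemma bridge_att_gt1 C D F : C != set0 -> isBridge C D F -> 1 < #|att C F|.
Proof.
move=> C0 [[_ [c [[cC sC tC st] ->]]]|[cD ->]]; last exact: comp_att_gt1.
rewrite (_ : att C [set c] = [set src c; tgt c]) ?cards2 ?st //.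
rewrite /Defs.att (verts1 (joins_ends ends c)); apply/setIidPr/subsetP => x.
by case/set2P=> ->.
Qed.

(** Only edges with both ends in [D] are used, so paths obtained from this connection stay off
    [C]. *)
Lemma comp_inner_connect C D x y : isComp C D -> x \in D -> y \in D ->
  connect (adjF [set f | (src f \in D) && (tgt f \in D)]) x y.
Proof.
move=> cD xD; rewrite (isComp_eq cD xD) => /compP[_ /connectP[p pth ->]].
rewrite -(isComp_eq cD xD); elim: p x xD pth => [|z p IH] x xD //= /andP[].
case/and3P=> xC zC /adjFP[f _ J] pth; have zD := comp_joins cD xD J zC.
apply: connect_trans (IH z zD pth); apply: connect1; apply/adjFP; exists f => //.
by rewrite inE; case/orP: J => /andP[/eqP-> /eqP->]; rewrite xD zD.
Qed.

Lemma att_edge C D u : isComp C D -> u \in att C (compEdges D) ->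
  exists f x, [/\ f \in compEdges D, joins f u x, x \in D & u \in verts C].
Proof.
move=> cD; rewrite in_setI => /andP[uC /vertsP[f fF fu]].
case/compEdgesP: (fF) => x xD fx; have [y J] := incident_joins fu.
exists f, x; split=> //; move: fx; rewrite (joins_incident _ J) => /orP[]/eqP e; subst x => //.
by have := comp_off cD xD; rewrite uC.
Qed.

(** One edge leads from [u] into [D], and the path then stays in [D] until it first hits [T]; hence
    [u] is its only vertex on [C]. *)
Lemma comp_first_path C D u T t : isComp C D -> u \in att C (compEdges D) ->
  t \in T -> t \in D -> u \notin T ->
  exists P t', [/\ P \subset compEdges D, isPath P u t', t' \in T, t' \in D &
    (forall x, x \in verts P -> x \in T -> x = t') /\
    (forall x, x \in verts P -> x \in verts C -> x = u)].
Proof.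
move=> cD uA tT tD uT; have [f [x [fF J xD uC]]] := att_edge cD uA.
pose inn := [set f | (src f \in D) && (tgt f \in D)].
have ct : connect (adjF (f |: inn)) u t.
  apply: (@connect_trans _ _ x); first by apply: connect1; apply/adjFP; exists f; rewrite ?setU11.
  by apply: connectFS (comp_inner_connect cD xD tD); apply: subsetUr.
have [P [t' [PF pP tT' PT]]] := first_path ct uT tT.
have PD y : y \in verts P -> y = u \/ y \in D.
  move/(subsetP (vertsS _ PF)); rewrite vertsU in_setU (verts1 J) in_set2.
  case/orP=> [/orP[]/eqP->|]; [by left|by right|].
  by case/vertsP=> g; rewrite inE => /andP[gs gt] /orP[]/eqP<-; right.
exists P, t'; split=> //.
- apply: subset_trans PF _; rewrite subUset sub1set fF; apply/subsetP=> g.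
  by rewrite !inE => /andP[->].
- by case: (PD _ (path_r pP)) => // e; rewrite -e tT' in uT.
by split=> // y /PD[//|yD] yC; have := comp_off cD yD; rewrite yC.
Qed.

Lemma path_through_exists C D F u w : isBridge C D F -> u \in att C F -> w \in att C F ->
  u != w -> exists P, pathThrough ends C F P u w.
Proof.
case=> [[_ [c [[cC sC tC st] ->]]]|[cD ->]] uA wA nuw.
  have J : joins c u w.
    move: uA wA nuw; rewrite !in_setI (verts1 (joins_ends ends c)).
    case/andP=> _ /set2P[]-> /andP[_ /set2P[]->]; rewrite ?eqxx // => _; first exact: joins_ends.
    by rewrite joins_sym joins_ends.
  exists [set c]; split=> //; first exact: path1.
  rewrite (verts1 J); apply/setIidPl/subsetP => x /set2P[]->.
    by move: uA; rewrite in_setI => /andP[].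
  by move: wA; rewrite in_setI => /andP[].
(* The last edge [g] is fixed first. A path from [u] to its end [y] in [D] meets [C] only at [u], so
   [g] can be appended. *)
have [g [y [gF J yD wC]]] := att_edge cD wA.
have yC := comp_off cD yD.
have uC : u \in verts C by move: uA; rewrite in_setI => /andP[].
have uy : u \notin [set y] by rewrite in_set1; apply: contraNneq yC => <-.
have [P [t [PF pP /set1P te _ [_ PC]]]] := comp_first_path cD uA (set11 y) yD uy; subst t.
have wP : w \notin verts P by apply: contraNN nuw => /PC ->.
have ny : y != w by apply: contraNneq yC => ->.
have pg : isPath [set g] y w by apply: path1; rewrite // joins_sym.
have [|pPg _] := path_cat pP pg.
  by move=> x xP; rewrite (verts1 J) => /set2P[e|//]; rewrite -e xP in wP.
exists (P :|: [set g]); split=> //; first by rewrite subUset PF sub1set.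
apply/setP=> x; rewrite in_setI vertsU in_setU (verts1 J) !in_set2.
apply/idP/idP.
  case/andP=> /orP[xP xC|/orP[]/eqP->]; first by rewrite (PC _ xP xC) eqxx.
    by rewrite eqxx orbT.
  by rewrite (negbTE yC).
by case/orP=> /eqP->; rewrite ?uC ?wC ?(path_l pP) ?eqxx ?orbT.
Qed.

(** * Potentials on paths, ears and blocks *)

Section Balance.
Variable neg : E -> bool.
Local Notation negS := (negS neg).

Lemma negSE F : negS F = \big[addb/false]_(f in F) neg f.
Proof. by rewrite /Defs.negS odd_card. Qed.

Lemma negSU A B : [disjoint A & B] -> negS (A :|: B) = negS A (+) negS B.
Proof. by move=> d; rewrite !negSE -bigU //; apply: eq_bigl => f; rewrite !inE. Qed.

Lemma negSD X Y : X \subset Y -> negS Y = negS X (+) negS (Y :\: X).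
Proof. by move=> XY; rewrite -negSU ?disjointDr // setUDr. Qed.

(** A switching function that makes all edges of [F] positive: a certificate that [F] is
    balanced. *)
Definition potential (z : V -> bool) F := forall f, f \in F -> neg f = z (src f) (+) z (tgt f).

Lemma potential_path z P u w : isPath P u w -> potential z P -> negS P = z u (+) z w.
Proof. by move=> pP zP; rewrite negSE -(path_handshake z pP); apply: eq_bigr. Qed.

(** Signs propagate from [u]. The start value [a] is free so that the result can be glued to a
    potential already given at [u]. *)
Lemma path_potential P u w a : isPath P u w -> exists2 z, z u = a & potential z P.
Proof.
move: {2}#|P| (leqnn #|P|) => n; elim: n P u a => [|n IH] P u a leP pP.
  have [f fP] := path_n0 pP; move: leP; rewrite leqn0 cards_eq0 => /eqP P0.
  by rewrite P0 in_set0 in fP.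
have /vertsP[f fP fu] := path_l pP; have [v J] := incident_joins fu.
have nuv : u != v.
  by have := path_noloop pP fP; case/orP: J => /andP[/eqP-> /eqP->] //; rewrite eq_sym.
have fsub : [set f] \subset P by rewrite sub1set.
have p1 := path1 J nuv.
have [vw|vw] := eqVneq v w.
  rewrite vw in p1; exists (fun x => if x == u then a else a (+) neg f); first by rewrite eqxx.
  rewrite -(subpath_eq fsub pP p1) => g /set1P->.
  by case/orP: J => /andP[/eqP-> /eqP->]; rewrite eqxx [v == u]eq_sym (negbTE nuv);
     case: a; case: (neg f).
have [pS I] := path_suffix fsub pP p1 vw.
have uS : u \notin verts (P :\: [set f]).
  by apply: contraNN nuv => uS; rewrite (I u) // (path_l p1).
have [|z zv zP] := IH _ v (a (+) neg f) _ pS.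
  by move: leP; rewrite (cardsD1 f) fP.
exists (fun x => if x == u then a else z x); first by rewrite eqxx.
move=> g gP; have [->|gf] := eqVneq g f.
  by case/orP: J => /andP[/eqP-> /eqP->]; rewrite eqxx [v == u]eq_sym (negbTE nuv) zv;
     case: (a); case: (neg f).
have gS : g \in P :\: [set f] by rewrite !inE gf.
have ng x : incident g x -> (x == u) = false.
  by move=> gx; apply/negbTE; apply: contraNneq uS => <-; apply: mem_verts gS gx.
by rewrite !ng ?zP // /Defs.incident eqxx ?orbT.
Qed.

(** Invariant of the ear decomposition. Only circles through [e] have known sign, so every ear must
    be closable inside [F] by a path through [e]. *)
Definition pathsVia e F := forall u w, u \in verts F -> w \in verts F -> u != w ->
  exists P, [/\ P \subset F, isPath P u w & e \in P].

Lemma pathsVia_circle e C : isCircle C -> e \in C -> pathsVia e C.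
Proof.
move=> cC eC u w uC wC nuw; have [[_ cn] _] := cC.
have [Q QC pQ] := connect_path (cn _ _ uC wC) nuw.
have [eQ|eQ] := boolP (e \in Q); first by exists Q.
exists (C :\: Q); split; [exact: subsetDl| |by rewrite inE eQ].
by have [] := circle_compl cC QC pQ.
Qed.

Definition ear F P u w := [/\ isPath P u w, [disjoint P & F] &
  forall x, (x \in verts P) && (x \in verts F) = (x == u) || (x == w)].

Lemma ear_sym F P u w : ear F P u w -> ear F P w u.
Proof. by case=> pP d I; split=> //; [exact: path_sym|move=> x; rewrite orbC]. Qed.

Lemma ear_l F P u w : ear F P u w -> u \in verts F.
Proof. by case=> _ _ /(_ u); rewrite eqxx => /andP[]. Qed.

(** The bridge lemmas do not require their base to be a circle: with base [F], a path through a
    bridge is an ear. *)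
Lemma ear_exists F f g : F != set0 -> g != f -> f \notin F -> exists P u w, ear F P u w.
Proof.
move=> F0 gf fF; have [_ [D bD]] := bridgeOf_bridge fF (block_noloop gf).
have /card_gt1P[u [w [uA wA nuw]]] := bridge_att_gt1 F0 bD.
have [P [PF pP _ _ I]] := path_through_exists bD uA wA nuw.
exists P, u, w; split=> //; last by move=> x; rewrite -in_setI I in_set2.
rewrite disjoint_subset; apply/subsetP=> h hP; rewrite inE.
exact: bridge_notin bD (subsetP PF _ hP).
Qed.

(** Go from [p] along the ear to [u], then through [e] inside [F] to [v]. When [v] is [u], the ear
    is used in the other direction. *)
Lemma pathsVia_ear1 e F P u w p v : pathsVia e F -> ear F P u w ->
  p \in verts P -> p != u -> p != w -> v \in verts F -> v != u ->
  exists Q, [/\ Q \subset F :|: P, isPath Q p v & e \in Q].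
Proof.
move=> T eP pP pu pw vF vu; have [pathP d I] := eP.
have [L [R [PE pL pR ILR]]] := path_split pathP pP pu pw.
have uv : u != v by rewrite eq_sym.
have [Q [QF pQ eQ]] := T _ _ (ear_l eP) vF uv.
have [|pLQ _] := path_cat (path_sym pL) pQ.
  move=> x xL xQ; have := I x.
  rewrite (subsetP (vertsS _ QF) _ xQ) PE vertsU in_setU xL /= => /esym/orP[/eqP//|/eqP e'].
  by move: xL; rewrite e' => /ILR/(_ (path_r pR)) e''; rewrite e'' eqxx in pw.
exists (L :|: Q); split=> //; last by rewrite inE eQ orbT.
by rewrite PE setUC setUSS // subsetUl.
Qed.

(** The order on the ear is [u], [p], [q], [w]: go back from [p] to [u], cross [F] through [e] to
    [w], and return to [q]. *)
Lemma pathsVia_ear2 e F P L R u w p q : pathsVia e F -> ear F P u w ->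
  P = L :|: R -> isPath L u p -> isPath R p w ->
  (forall x, x \in verts L -> x \in verts R -> x = p) ->
  p != u -> p != w -> q \in verts R -> q != p -> q != w ->
  exists Q, [/\ Q \subset F :|: P, isPath Q p q & e \in Q].
Proof.
move=> T eP PE pL pR ILR pu pw qR qp qw; have [pathP d I] := eP.
have [R1 [R2 [RE pR1 pR2 IR]]] := path_split pR qR qp qw.
have [Q [QF pQ eQ]] := T _ _ (ear_l eP) (ear_l (ear_sym eP)) (path_neq pathP).
have wL : w \notin verts L.
  by apply: contraNN pw => /ILR/(_ (path_r pR))->.
have uR : u \notin verts R.
  by apply: contraNN pu => /(ILR _ (path_l pL))->.
have R2R x : x \in verts R2 -> x \in verts R by rewrite RE vertsU in_setU => ->; rewrite orbT.
have F2 x : x \in verts P -> x \in verts Q -> x = u \/ x = w.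
  move=> xP /(subsetP (vertsS _ QF)) xF; have := I x; rewrite xP xF => /esym/orP[]/eqP; auto.
have LP x : x \in verts L -> x \in verts P by rewrite PE vertsU in_setU => ->.
have RP x : x \in verts R -> x \in verts P by rewrite PE vertsU in_setU => ->; rewrite orbT.
have [|pLQ _] := path_cat (path_sym pL) pQ.
  move=> x xL xQ; case: (F2 _ (LP _ xL) xQ) => // e'.
  by rewrite -e' xL in wL.
have [|pA _] := path_cat pLQ (path_sym pR2).
  move=> x; rewrite vertsU in_setU => /orP[xL|xQ] x2.
    have e' := ILR _ xL (R2R _ x2); rewrite e' in x2.
    by have e'' := IR _ (path_l pR1) x2; rewrite e'' eqxx in qp.
  case: (F2 _ (RP _ (R2R _ x2)) xQ) => // e'.
  by have := R2R _ x2; rewrite e' (negbTE uR).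
exists (L :|: Q :|: R2); split=> //; last by rewrite !inE eQ orbT.
apply/subsetP=> h; rewrite PE RE !inE => /orP[/orP[->|/(subsetP QF)->]|->]; rewrite ?orbT //.
Qed.

Lemma pathsVia_ear e F P u w : pathsVia e F -> ear F P u w -> pathsVia e (F :|: P).
Proof.
move=> T eP; have [pathP d I] := eP.
have mixed p v : p \in verts P -> p \notin verts F -> v \in verts F ->
    exists Q, [/\ Q \subset F :|: P, isPath Q p v & e \in Q].
  move=> pP pF vF.
  have pu : p != u by apply: contraNneq pF => ->; apply: ear_l eP.
  have pw : p != w by apply: contraNneq pF => ->; apply: ear_l (ear_sym eP).
  have [->|vu] := eqVneq v u; last exact: pathsVia_ear1 T eP pP pu pw vF vu.
  by apply: (pathsVia_ear1 T (ear_sym eP)) => //; [exact: ear_l eP|exact: path_neq pathP].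
move=> p q pFP qFP npq.
have [pF|pF] := boolP (p \in verts F); have [qF|qF] := boolP (q \in verts F).
- have [Q [QF pQ eQ]] := T _ _ pF qF npq; exists Q; split=> //.
  exact: subset_trans QF (subsetUl _ _).
- have qP : q \in verts P by move: qFP; rewrite vertsU in_setU (negbTE qF).
  by have [Q [QF pQ eQ]] := mixed _ _ qP qF pF; exists Q; split=> //; apply: path_sym.
- have pP : p \in verts P by move: pFP; rewrite vertsU in_setU (negbTE pF).
  exact: mixed.
have pP : p \in verts P by move: pFP; rewrite vertsU in_setU (negbTE pF).
have qP : q \in verts P by move: qFP; rewrite vertsU in_setU (negbTE qF).
have uF := ear_l eP; have wF := ear_l (ear_sym eP).
have pu : p != u by apply: contraNneq pF => ->.
have pw : p != w by apply: contraNneq pF => ->.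
have qu : q != u by apply: contraNneq qF => ->.
have qw : q != w by apply: contraNneq qF => ->.
have [L [R [PE pL pR ILR]]] := path_split pathP pP pu pw.
have nqp : q != p by rewrite eq_sym.
move: (qP); rewrite {1}PE vertsU in_setU => /orP[qL|qR]; last first.
  exact: pathsVia_ear2 T eP PE pL pR ILR pu pw qR nqp qw.
apply: (pathsVia_ear2 T (ear_sym eP) _ (path_sym pR) (path_sym pL)) => //.
  by rewrite setUC.
by move=> x xR xL; apply: ILR.
Qed.

(** The ear and a path of [F] through [e] form a positive circle, so the potential propagated along
    the ear from [u] arrives at [w] with the value already there. *)
Lemma potential_ear e F P u w z : pathsVia e F -> ear F P u w -> potential z F ->
  (forall C, isCircle C -> e \in C -> negS C = false) ->
  exists z', potential z' (F :|: P).
Proof.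
move=> T eP zF pos; have [pathP d I] := eP.
have uF := ear_l eP; have wF := ear_l (ear_sym eP).
have [zP zPu zPP] := path_potential (z u) pathP.
have [Q [QF pQ eQ]] := T _ _ uF wF (path_neq pathP).
have dPQ : [disjoint P & Q] by apply: disjointWr d.
have zPw : zP w = z w.
  have cPQ : isCircle (P :|: Q).
    apply: circle_of_paths pathP pQ dPQ _ => x xP /(subsetP (vertsS _ QF)) xF.
    by have := I x; rewrite xP xF => /esym/orP[]/eqP; auto.
  have := pos _ cPQ; rewrite inE eQ orbT => /(_ isT); rewrite negSU //.
  have zQ : potential z Q by move=> f /(subsetP QF); apply: zF.
  rewrite (potential_path pathP zPP) (potential_path pQ zQ) zPu.
  by case: (z u); case: (z w); case: (zP w).
exists (fun v => if v \in verts F then z v else zP v) => f; rewrite inE.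
case: (boolP (f \in F)) => [fF _|fF /= fP].
  have /andP[-> ->] := joins_verts fF (joins_ends ends f); exact: zF.
have agree v : incident f v -> (if v \in verts F then z v else zP v) = zP v.
  move=> fv; case: ifP => // vF; have := I v.
  by rewrite vF (mem_verts fP fv) => /esym/orP[]/eqP->.
by rewrite !agree ?zPP // /Defs.incident eqxx ?orbT.
Qed.

(** Propagate along [C] without [e]; positivity of [C] makes the two ends agree across [e]. *)
Lemma potential_circle e C : isCircle C -> e \in C -> src e != tgt e -> negS C = false ->
  exists z, potential z C.
Proof.
move=> cC eC st nC; have eS : [set e] \subset C by rewrite sub1set.
have [pC _] := circle_compl cC eS (path1 (joins_ends ends e) st).
have [z _ zC] := path_potential false pC.
exists z => f fC; have [->|fe] := eqVneq f e; last by apply: zC; rewrite !inE fe.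
move: nC; rewrite (negSD eS) (potential_path pC zC) negSE big_set1.
by case: (neg e); case: (z _); case: (z _).
Qed.

(* Ear decomposition of the block starting from C: [pathsVia] makes each new ear
   part of a circle through e, so the potential extends over it. *)
Lemma potential_of_circles e C : isCircle C -> e \in C -> (exists g, g != e) ->
  (forall C', isCircle C' -> e \in C' -> negS C' = false) ->
  exists z, potential z setT.
Proof.
move=> cC eC [g ge] pos.
have noloop f : src f != tgt f.
  have [->|fe] := eqVneq f e; first exact: block_noloop ge.
  by apply: (@block_noloop _ e); rewrite eq_sym.
have base : exists z, potential z C.
  by apply: (potential_circle cC eC) => //; exact: pos.
suff extend n F : #|~: F| <= n -> e \in F -> (exists z, potential z F) -> pathsVia e F ->
    exists z, potential z setT.
  exact: (extend _ C (leqnn _) eC base (pathsVia_circle cC eC)).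
elim: n F => [|n IH] F leF eF [z zF] T.
  move: leF; rewrite leqn0 cards_eq0 => /eqP F0; exists z.
  by rewrite -setC0 -F0 setCK.
have [FT|[f]] := set_0Vmem (~: F); first by exists z; rewrite -setC0 -FT setCK.
rewrite inE => fF.
have F0 : F != set0 by apply/set0Pn; exists e.
have ef : e != f by apply: contraNneq fF => <-.
have [P [u [w eP]]] := ear_exists F0 ef fF.
apply: (IH (F :|: P)).
- have [h hP] : exists h, h \in P by case: eP => /path_n0.
  rewrite -ltnS; apply: leq_trans leF; apply: proper_card.
  rewrite properE setCS subsetUl /=; apply/subsetPn; exists h; last by rewrite !inE hP orbT.
  by rewrite inE; case: eP => _ d _; rewrite (disjointFr d hP).
- by rewrite inE eF.
- exact: potential_ear T eP zF pos.
exact: pathsVia_ear eP.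
Qed.

End Balance.
End Bridges.

(** * Linear layout of a circle with one edge removed *)

Section Coordinates.
Variables (V E : finType) (ends : E -> V * V).

Local Notation src f := (ends f).1.
Local Notation tgt f := (ends f).2.
Local Notation joins := (joins ends).
Local Notation verts := (verts ends).
Local Notation isCircle := (isCircle ends).
Local Notation isPath := (isPath ends).
Local Notation isComp := (isComp ends).
Local Notation isBridge := (isBridge ends).
Local Notation compEdges := (compEdges ends).
Local Notation att := (att ends).
Local Notation pathThrough := (pathThrough ends).
Implicit Types (F X Y Z P Q L R C A B : {set E}) (f g : E) (u v w x : V) (D T : {set V}).

(** Gives a degree-defined path its linear order by peeling off the edge at [u]. The functions are
    total on [nat]; only [c] up to [n] and [d] below [n] carry meaning. *)
Lemma path_coords P u w : isPath P u w -> exists n (c : nat -> V) (d : nat -> E),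
  [/\ 0 < n, c 0 = u /\ c n = w,
      forall i j, i <= n -> j <= n -> c i = c j -> i = j,
      forall i, i < n -> joins (d i) (c i) (c i.+1) &
      forall f, f \in P <-> exists2 i, i < n & f = d i].
Proof.
move: {2}#|P| (leqnn #|P|) => m; elim: m P u => [|m IH] P u leP pP.
  have [f fP] := path_n0 pP; move: leP; rewrite leqn0 cards_eq0 => /eqP P0.
  by rewrite P0 in_set0 in fP.
have /vertsP[f fP fu] := path_l pP; have [v J] := incident_joins fu.
have nuv : u != v.
  by have := path_noloop pP fP; case/orP: J => /andP[/eqP-> /eqP->] //; rewrite eq_sym.
have fsub : [set f] \subset P by rewrite sub1set.
have p1 := path1 J nuv.
have [vw|vw] := eqVneq v w.
  rewrite vw in p1 J nuv; exists 1, (fun i => if i is 0 then u else w), (fun=> f); split=> //.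
  - move=> [|[|i]] [|[|j]] //= _ _ e; first by rewrite e eqxx in nuv.
    by rewrite -e eqxx in nuv.
  - by case.
  - move=> g; rewrite -(subpath_eq fsub pP p1) in_set1.
    by split=> [/eqP->|[_ _ ->]//]; exists 0.
have [pS I] := path_suffix fsub pP p1 vw.
have uS : u \notin verts (P :\: [set f]).
  by apply: contraNN nuv => uS; rewrite (I u) // (path_l p1).
have [|n [c [d [n0 [c0 cn] inj Jd PE]]]] := IH _ v _ pS.
  by move: leP; rewrite (cardsD1 f) fP.
have cu i : i <= n -> c i != u.
  move=> lin; apply: contraNneq uS => <-.
  case: i lin => [|i] lin.
    by have [_ h] := PE (d 0); have/andP[->] := joins_verts (h (ex_intro2 _ _ 0 n0 erefl)) (Jd 0 n0).
  by have [_ h] := PE (d i); have/andP[_ ->] :=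
    joins_verts (h (ex_intro2 _ _ i lin erefl)) (Jd i lin).
exists n.+1, (fun i => if i is k.+1 then c k else u), (fun i => if i is k.+1 then d k else f).
split=> //.
- move=> [|i] [|j] //= li lj e.
  + by have := cu j lj; rewrite -e eqxx.
  + by have := cu i li; rewrite e eqxx.
  + by congr _.+1; apply: inj.
- by move=> [|i] //= li; [rewrite c0|apply: Jd].
move=> g; split=> [gP|[[|i] li ->]] //=; last first.
  by have [_ /(_ (ex_intro2 _ _ i li erefl))] := PE (d i); rewrite inE => /andP[].
have [->|gf] := eqVneq g f; first by exists 0.
have [h _] := PE g; have [|i li ->] := h; first by rewrite !inE gf.
by exists i.+1.
Qed.

(* The circle C minus the edge e, laid out as the path
   c 0, d 0, c 1, ..., d n.-1, c n. *)
Record frame C e n (c : nat -> V) (d : nat -> E) : Prop := Frame {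
  frame_gt0 : 0 < n;
  frame_inj : forall i j, i <= n -> j <= n -> c i = c j -> i = j;
  frame_joins : forall i, i < n -> joins (d i) (c i) (c i.+1);
  frame_edges : forall f, f \in C :\ e <-> exists2 i, i < n & f = d i;
  frame_mem : e \in C;
  frame_circle : isCircle C;
  frame_closing : joins e (c 0) (c n) }.

Lemma frame_exists C e : isCircle C -> e \in C -> src e != tgt e ->
  exists n c d, frame C e n c d.
Proof.
move=> cC eC st; have eS : [set e] \subset C by rewrite sub1set.
have [pC _] := circle_compl cC eS (path1 (joins_ends ends e) st).
have [n [c [d [n0 [c0 cn] inj Jd CE]]]] := path_coords pC.
by exists n, c, d; split=> //; rewrite c0 cn joins_ends.
Qed.

Section Frame.
Variables (C : {set E}) (e : E) (n : nat) (c : nat -> V) (d : nat -> E).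
Hypothesis fr : frame C e n c d.

Let inj := frame_inj fr.
Let Jd := frame_joins fr.
Let cC := frame_circle fr.

(** Edge indices are half-open: the edges from [i] to [j] exclusive join [c i] to [c j]. The ordinal
    [k] truncates at [n], so an arc never contains [e]. *)
Definition carc i j : {set E} := [set f | [exists k : 'I_n, (i <= k < j) && (f == d k)]].

Lemma edge_inj i j : i < n -> j < n -> d i = d j -> i = j.
Proof.
move=> li lj eij; have J1 := Jd li; have J2 := Jd lj; rewrite eij in J1.
have := joins_incident (c i) J2; rewrite (joins_incident _ J1) eqxx /= => /esym/orP[]/eqP h.
  by apply: inj h; apply: ltnW.
have := joins_incident (c i.+1) J2; rewrite (joins_incident _ J1) eqxx orbT /=.
move=> /esym/orP[]/eqP h'.
  (* The crossed matching of ends would give both [i = j.+1] and [i.+1 = j]. *)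
  by have := inj (ltnW li) lj h; have := inj li (ltnW lj) h'; lia.
by have := inj li lj h' => -[].
Qed.

Lemma arcP i j f : j <= n -> reflect (exists2 k, i <= k < j & f = d k) (f \in carc i j).
Proof.
move=> ljn; rewrite inE; apply: (iffP existsP) => [[k /andP[lk /eqP->]]|[k lk ->]].
  by exists k.
have lkn : k < n by lia.
by exists (Ordinal lkn); rewrite lk eqxx.
Qed.

Lemma mem_arc i j k : k < n -> (d k \in carc i j) = (i <= k < j).
Proof.
move=> lk; rewrite inE; apply/existsP/idP => [[l /andP[ll /eqP h]]|lk'].
  by rewrite (edge_inj lk (ltn_ord l) h).
by exists (Ordinal lk); rewrite lk' eqxx.
Qed.

Lemma edge_mem k : k < n -> d k \in C :\ e.
Proof. by move=> lk; have [_] := frame_edges fr (d k); apply; exists k. Qed.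

Lemma arc_subD1 i j : carc i j \subset C :\ e.
Proof.
apply/subsetP=> f; rewrite [f \in carc _ _]inE => /existsP[k /andP[_ /eqP->]].
exact: edge_mem.
Qed.

Lemma arc_sub i j : carc i j \subset C.
Proof. exact: subset_trans (arc_subD1 i j) (subsetDl _ _). Qed.

Lemma arc_notin i j : e \notin carc i j.
Proof. by apply/negP => /(subsetP (arc_subD1 i j)); rewrite !inE eqxx. Qed.

Lemma arc_disjoint i j k l : j <= k -> [disjoint carc i j & carc k l].
Proof.
move=> ljk; rewrite disjoint_subset; apply/subsetP => f.
rewrite inE => /existsP[m /andP[lm /eqP->]].
by rewrite inE mem_arc //; lia.
Qed.

Lemma arcU i j k : i <= j <= k -> carc i j :|: carc j k = carc i k.
Proof.
move=> lijk; apply/setP=> f; rewrite in_setU; apply/orP/idP.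
  by case; rewrite inE => /existsP[m /andP[lm /eqP->]]; rewrite mem_arc //; lia.
rewrite inE => /existsP[m /andP[lm /eqP->]]; rewrite !mem_arc //; apply/orP; lia.
Qed.

Lemma arcS i j k l : k <= i -> j <= l -> carc i j \subset carc k l.
Proof.
move=> ki jl; apply/subsetP=> f; rewrite inE => /existsP[m /andP[lm /eqP->]].
rewrite mem_arc //; lia.
Qed.

Lemma arc1 i : i < n -> carc i i.+1 = [set d i].
Proof.
move=> li; apply/setP=> f; rewrite in_set1; apply/arcP/eqP => //.
  by case=> k lk ->; congr d; lia.
by move=> ->; exists i => //; lia.
Qed.

Lemma mem_verts_arc i j k : i < j -> j <= n -> k <= n ->
  (c k \in verts (carc i j)) = (i <= k <= j).
Proof.
move=> lij ljn lkn; apply/vertsP/idP.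
  case=> f /(arcP _ _ ljn)[m lm ->]; have lmn : m < n by lia.
  have lmn' := ltnW lmn.
  rewrite (joins_incident _ (Jd lmn)) => /orP[]/eqP/inj h; first by rewrite h //; lia.
  by rewrite h //; lia.
move=> lk; have [ekj|nkj] := eqVneq k j.
  have lj1 : j.-1 < n by lia.
  exists (d j.-1); first by rewrite mem_arc //; lia.
  by rewrite (joins_incident _ (Jd lj1)) prednK ?ekj ?eqxx ?orbT //; lia.
have lkn' : k < n by lia.
exists (d k); first by rewrite mem_arc //; lia.
by rewrite (joins_incident _ (Jd lkn')) eqxx.
Qed.

Lemma coord_mem k : k <= n -> c k \in verts C.
Proof.
move=> lk; have := mem_verts_arc (frame_gt0 fr) (leqnn n) lk; rewrite lk /=.
exact: (subsetP (vertsS _ (arc_sub 0 n))).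
Qed.

Lemma coord_exists v : v \in verts C -> exists2 k, k <= n & v = c k.
Proof.
case/vertsP=> f fC fv; have [fe|fe] := eqVneq f e.
  move: fv; rewrite fe (joins_incident _ (frame_closing fr)) => /orP[]/eqP->; first by exists 0.
  by exists n.
have [h _] := frame_edges fr f; have [|i li fE] := h; first by rewrite !inE fe.
move: fv; rewrite fE (joins_incident _ (Jd li)) => /orP[]/eqP->; last by exists i.+1.
by exists i; first exact: ltnW.
Qed.

Lemma verts_arc_coord i j v : i < j -> j <= n -> v \in verts (carc i j) ->
  exists2 k, i <= k <= j & v = c k.
Proof.
move=> lij ljn vA; have [k lk vE] := coord_exists (subsetP (vertsS _ (arc_sub i j)) _ vA).
by exists k => //; rewrite -(mem_verts_arc lij ljn lk) -vE.
Qed.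

Lemma coord_neq i j : i < j -> j <= n -> c i != c j.
Proof.
move=> lij ljn; apply/eqP => /inj h; have : i = j by apply: h => //; lia.
by lia.
Qed.

Lemma arc_path i j : i < j -> j <= n -> isPath (carc i j) (c i) (c j).
Proof.
move=> + ljn; elim: j ljn => [//|j IH] ljn; rewrite ltnS leq_eqVlt => /orP[/eqP->|lij].
  by rewrite arc1 //; apply: path1 (Jd ljn) (coord_neq _ _).
have pA := IH (ltnW ljn) lij.
have p1 : isPath (carc j j.+1) (c j) (c j.+1).
  by rewrite arc1 //; apply: path1 (Jd ljn) (coord_neq _ _).
rewrite -(@arcU i j j.+1); last by lia.
apply: (proj1 (path_cat pA p1 _)) => x xA.
have [k lk ->] := verts_arc_coord lij (ltnW ljn) xA.
by rewrite mem_verts_arc; [move=> h; congr c; lia|lia|lia|lia].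
Qed.

Lemma arc_compl_path i j : i < j -> j <= n -> isPath (C :\: carc i j) (c i) (c j).
Proof.
by move=> lij ljn; have [] := circle_compl cC (arc_sub i j) (arc_path lij ljn).
Qed.

Lemma mem_verts_compl i j k : i < j -> j <= n -> k <= n ->
  (c k \in verts (C :\: carc i j)) = ~~ (i < k < j).
Proof.
move=> lij ljn lkn; have [pA I] := circle_compl cC (arc_sub i j) (arc_path lij ljn).
have [kij|kij] := boolP (i < k < j).
  apply/negbTE/negP => kC; case: (I (c k)) => //; first by rewrite mem_verts_arc //; lia.
    by move/inj => h; have := h lkn; lia.
  by move/inj => h; have := h lkn; lia.
rewrite /=; have [->|ki] := eqVneq k i; first exact: path_l pA.
have [->|kj] := eqVneq k j; first exact: path_r pA.
have := coord_mem lkn; rewrite -{1}(setUDr (arc_sub i j)) vertsU in_setU mem_verts_arc //.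
by rewrite (_ : _ <= _ <= _ = false) //; lia.
Qed.

Lemma arc_cases i j Q : i < j -> j <= n -> Q \subset C -> isPath Q (c i) (c j) ->
  Q = carc i j \/ Q = C :\: carc i j.
Proof.
by move=> lij ljn QC pQ; apply: circle_paths pQ (arc_path lij ljn); rewrite ?arc_sub.
Qed.

Lemma through_disjoint D F P u w : isBridge C D F -> pathThrough C F P u w ->
  [disjoint P & C].
Proof.
move=> bD [PF _ _ _ _]; rewrite disjoint_subset; apply/subsetP=> f /(subsetP PF) fF.
by rewrite inE; apply: bridge_notin bD fF.
Qed.

Lemma through_path F P u w : pathThrough C F P u w -> isPath P u w.
Proof. by case. Qed.

Lemma through_verts F P u w x : pathThrough C F P u w -> x \in verts P -> x \in verts C ->
  x = u \/ x = w.
Proof.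
by case=> _ _ _ _ I xP xC; apply/set2P; rewrite -I in_setI xP.
Qed.

(** A path [L] from [v] first hits [R] at a vertex [x]. The three legs from [x] form the three paths
    pairwise, and [L], used by both [P] and [Q], cancels in the signs. *)
Lemma tripod D u v w (neg : E -> bool) : isComp C D ->
  u \in att C (compEdges D) -> v \in att C (compEdges D) -> w \in att C (compEdges D) ->
  u != v -> v != w -> u != w ->
  exists P Q R, [/\ pathThrough C (compEdges D) P u v, pathThrough C (compEdges D) Q v w,
    pathThrough C (compEdges D) R u w & negS neg R = negS neg P (+) negS neg Q].
Proof.
move=> cD uA vA wA nuv nvw nuw.
have bD : isBridge C D (compEdges D) by right.
have [R ptR] := path_through_exists bD uA wA nuw.
have [RF pR _ _ IR] := ptR.
have attC x : x \in att C (compEdges D) -> x \in verts C by rewrite in_setI => /andP[].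
have vF x : x \in verts (compEdges D) -> (x \in D) || (x \in verts C).
  case/vertsP=> f fF fx; have [//|xC] := boolP (x \in verts C); first by rewrite orbT.
  by rewrite (comp_incident cD fF fx xC).
have [f fR] := path_n0 pR; have /compEdgesP[t tD ft] := subsetP RF _ fR.
have tR := mem_verts fR ft.
(* Aiming only at vertices of [R] in [D] makes [x] an inner vertex of [R], off [C]. *)
have tT : t \in verts R :&: D by rewrite in_setI tR.
have vT : v \notin verts R :&: D.
  by rewrite in_setI; apply/negP => /andP[_ /(comp_off cD)]; rewrite attC.
have [L [x [LF pL xT xD [LT LC]]]] := comp_first_path cD vA tT tD vT.
have xC := comp_off cD xD.
have xR : x \in verts R by move: xT; rewrite in_setI => /andP[].
have xu : x != u by apply: contraNneq xC => ->; apply: attC.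
have xw : x != w by apply: contraNneq xC => ->; apply: attC.
have [R1 [R2 [RE pR1 pR2 I12]]] := path_split pR xR xu xw.
have R1R : {subset verts R1 <= verts R} by move=> y; rewrite RE vertsU in_setU => ->.
have R2R : {subset verts R2 <= verts R} by move=> y; rewrite RE vertsU in_setU orbC => ->.
have RL y : y \in verts R -> y \in verts L -> y = x.
  move=> yR yL; apply: LT => //; rewrite in_setI yR /=.
  have /orP[//|yC] := vF _ (subsetP (vertsS _ RF) _ yR).
  have yv := LC _ yL yC; case: (through_verts ptR yR yC) => h.
    by rewrite -h yv eqxx in nuv.
  by rewrite -h yv eqxx in nvw.
have R1F : R1 \subset compEdges D by apply: subset_trans RF; rewrite RE subsetUl.
have R2F : R2 \subset compEdges D by apply: subset_trans RF; rewrite RE subsetUr.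
have [|pP dP] := path_cat pR1 (path_sym pL); first by move=> y /R1R yR; apply: RL.
have [|pQ dQ] := path_cat pL pR2; first by move=> y yL /R2R yR; apply: RL.
have [_ d12] := path_cat pR1 pR2 I12.
exists (R1 :|: L), (L :|: R2), R; split=> //.
- split=> //; first by rewrite subUset R1F.
  apply/setP=> y; rewrite in_setI vertsU in_setU in_set2; apply/idP/idP.
    case/andP=> /orP[yR yC|yL /(LC _ yL)->]; last by rewrite eqxx orbT.
    case: (through_verts ptR (R1R _ yR) yC) => h; first by rewrite h eqxx.
    move: yR; rewrite h => wR1; have := I12 _ wR1 (path_r pR2) => e'.
    by rewrite e' eqxx in xw.
  by case/orP=> /eqP->; rewrite ?(path_l pR1) ?(path_l pL) ?orbT attC.
- split=> //; first by rewrite subUset R2F LF.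
  apply/setP=> y; rewrite in_setI vertsU in_setU in_set2; apply/idP/idP.
    case/andP=> /orP[yL /(LC _ yL)->|yR yC]; first by rewrite eqxx.
    case: (through_verts ptR (R2R _ yR) yC) => h; last by rewrite h eqxx orbT.
    move: yR; rewrite h => uR2; have := I12 _ (path_l pR1) uR2 => e'.
    by rewrite e' eqxx in xu.
  by case/orP=> /eqP->; rewrite ?(path_r pR2) ?(path_l pL) ?orbT attC.
by rewrite RE !negSU //; case: (negS _ L); case: (negS _ R1); case: (negS _ R2).
Qed.

(** * Constraints on bridges from the battery property, for both signs *)

Section Battery.
Variable neg : E -> bool.
Local Notation negS := (negS neg).
Hypothesis battery : forall C', isCircle C' -> e \in C' -> C' <> C -> negS C' = ~~ negS C.

Lemma reroute D F P i j : isBridge C D F -> pathThrough C F P (c i) (c j) ->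
  i < j -> j <= n ->
  isCircle ((C :\: carc i j) :|: P) /\ [disjoint C :\: carc i j & P].
Proof.
move=> bD ptP lij ljn.
have dP : [disjoint C :\: carc i j & P].
  by rewrite disjoint_sym; apply: disjointWr (through_disjoint bD ptP); apply: subsetDl.
split=> //; apply: circle_of_paths (arc_compl_path lij ljn) (through_path ptP) dP _ => x.
by move=> /(subsetP (vertsS _ (subsetDl _ _))) xC xP; apply: through_verts ptP xP xC.
Qed.

Lemma off_neq D F P u w X : isBridge C D F -> pathThrough C F P u w -> X :|: P <> C.
Proof.
move=> bD ptP XC; have [f fP] := path_n0 (through_path ptP).
by have := disjointFr (through_disjoint bD ptP) fP; rewrite -XC inE fP orbT.
Qed.

(** Replacing the arc by [P] gives another circle through [e], of opposite sign; the common
    complement of the arc cancels. *)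
Lemma battery_through D F P i j : isBridge C D F -> pathThrough C F P (c i) (c j) ->
  i < j -> j <= n -> negS P = ~~ negS (carc i j).
Proof.
move=> bD ptP lij ljn; have [cR dR] := reroute bD ptP lij ljn.
have := battery cR; rewrite in_setU in_setD arc_notin (frame_mem fr) => /(_ isT (off_neq bD ptP)).
rewrite negSU // (negSD neg (arc_sub i j)).
by case: (negS P); case: (negS (carc i j)); case: (negS _).
Qed.

(** The three paths of a tripod have the signs opposite to the arcs they span. Both triples of signs
    should sum to zero, but they differ by an odd number of negations. *)
Lemma battery_att_le2 D F : isBridge C D F -> #|att C F| <= 2.
Proof.
move=> bD; rewrite leqNgt; apply/negP => gt2.
have cD : isComp C D /\ F = compEdges D.
  case: (bD) => // -[_ [ch [[chC _ _ st] FE]]].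
  move: gt2; rewrite ltnNge => /negP[]; rewrite FE.
  apply: leq_trans (subset_leq_card (subsetIr _ _)) _.
  by rewrite (verts1 (joins_ends ends ch)) cards2; case: (_ != _).
have no3 i j k : i < j -> j < k -> k <= n -> c i \in att C F -> c j \in att C F ->
    c k \in att C F -> False.
  case: cD => cD FE lij ljk lkn iA jA kA; rewrite FE in bD iA jA kA.
  have [||| P [Q [R [pP pQ pR S]]]] := tripod neg cD iA jA kA.
  - by apply: coord_neq => //; lia.
  - by apply: coord_neq => //; lia.
  - by apply: coord_neq => //; lia.
  move: S; rewrite (battery_through bD pP) ?(battery_through bD pQ) ?(battery_through bD pR);
    try lia.
  have lijk : i <= j <= k by lia.
  rewrite -(arcU lijk) negSU ?arc_disjoint //.
  by case: (negS (carc i j)); case: (negS _).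
have /card_gt2P[x [y [z [[xA yA zA] [xy yz zx]]]]] := gt2.
have inC v : v \in att C F -> v \in verts C by rewrite in_setI => /andP[].
have [i li xE] := coord_exists (inC _ xA); have [j lj yE] := coord_exists (inC _ yA).
have [k lk zE] := coord_exists (inC _ zA); subst x y z.
have ij : i <> j by move=> h; rewrite h eqxx in xy.
have jk : j <> k by move=> h; rewrite h eqxx in yz.
have ki : k <> i by move=> h; rewrite h eqxx in zx.
case: (ltngtP i j) => // lij; case: (ltngtP j k) => // ljk; case: (ltngtP i k) => lik;
  try lia; first [exact: (no3 i j k)|exact: (no3 i k j)|exact: (no3 j i k)|
                  exact: (no3 j k i)|exact: (no3 k i j)|exact: (no3 k j i)].
Qed.

(** The circle built from both bridges covers the arc from [k] to [j] once, while the arcs spanned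
    by [P] and [R] cover it twice; the two negations cancel and its sign is that of [C]. *)
Lemma battery_no_cross D1 F1 D2 F2 i j k l : isBridge C D1 F1 -> isBridge C D2 F2 ->
  att C F1 = [set c i; c j] -> att C F2 = [set c k; c l] ->
  i < k -> k < j -> j < l -> l <= n -> False.
Proof.
move=> b1 b2 a1 a2 lik lkj ljl lln.
have lij : i < j by lia. have lkl : k < l by lia. have lil : i < l by lia.
have lkn : k <= n by lia. have ljn : j <= n by lia. have lin : i <= n by lia.
have [|||P ptP] := @path_through_exists _ _ ends C D1 F1 (c i) (c j) b1;
  rewrite ?a1 ?set21 ?set22 //; first exact: coord_neq.
have [|||R ptR] := @path_through_exists _ _ ends C D2 F2 (c k) (c l) b2;
  rewrite ?a2 ?set21 ?set22 //; first exact: coord_neq.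
have pP := through_path ptP; have pR := through_path ptR.
have F12 : F1 <> F2.
  move=> h; have : c i \in att C F2 by rewrite -h a1 set21.
  rewrite a2 => /set2P[]/inj h'; first by have := h' lin lkn; lia.
  by have := h' lin lln; lia.
have PC x : x \in verts P -> x \in verts C -> x = c i \/ x = c j by apply: through_verts ptP.
have RC x : x \in verts R -> x \in verts C -> x = c k \/ x = c l by apply: through_verts ptR.
have PR x : x \in verts P -> x \in verts R -> x \in verts C.
  move=> xP xR; apply/negbNE/negP => xC; apply: F12.
  case: ptP => PF _ _ _ _; case: ptR => RF _ _ _ _.
  exact: bridge_eq_vertex b1 b2 (subsetP (vertsS _ PF) _ xP) (subsetP (vertsS _ RF) _ xR) xC.
have AC a b : {subset verts (carc a b) <= verts C}.
  by apply/subsetP/vertsS/arc_sub.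
have cK a b : a <= n -> b <= n -> a <> b -> c a <> c b.
  by move=> la lb nab h; apply: nab; apply: inj.
(* the fourth circle of K4: out along P, back along the arc [k, j], then out along R *)
have [|pPA dPA] := path_cat pP (path_sym (arc_path lkj ljn)).
  move=> x xP xA; have [h|//] := PC _ xP (AC _ _ _ xA).
  by move: xA; rewrite h mem_verts_arc //; lia.
have [|pW dW] := path_cat pPA pR.
  move=> x; rewrite vertsU in_setU => /orP[xP|xA] xR.
    have xC := PR _ xP xR; case: (PC _ xP xC) => h; case: (RC _ xR xC) => // h'; exfalso;
    rewrite h in h'; move: h'; apply: cK; lia.
  case: (RC _ xR (AC _ _ _ xA)) => // h; move: xA; rewrite h mem_verts_arc //; lia.
set W := _ :|: R in pW.
have dC : [disjoint C :\: carc i l & W].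
  have dO X : [disjoint X & C] -> [disjoint C :\: carc i l & X].
    by rewrite disjoint_sym; apply: disjointWl; apply: subsetDl.
  rewrite -setI_eq0 !setIUr !setU_eq0 !setI_eq0 (dO _ (through_disjoint b1 ptP))
    (dO _ (through_disjoint b2 ptR)) andbT /=.
  have sA : carc k j \subset carc i l by apply: arcS; lia.
  apply: disjointWr sA _.
  by rewrite disjoint_sym; apply: disjointDr.
have cW : isCircle ((C :\: carc i l) :|: W).
  apply: circle_of_paths (arc_compl_path lil lln) pW dC _ => x xO.
  have xC := subsetP (vertsS _ (subsetDl _ _)) _ xO.
  have kO a : i < a -> a < l -> c a \in verts (C :\: carc i l) -> False.
    by move=> h1 h2; rewrite mem_verts_compl //; lia.
  rewrite !vertsU !in_setU => /orP[/orP[xP|xA]|xR].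
  - by case: (PC _ xP xC) => h; [left|case: (kO j) => //; rewrite -h].
  - have [a la h] := verts_arc_coord lkj ljn xA; case: (kO a); try lia.
    by rewrite -h.
  - by case: (RC _ xR xC) => h; [case: (kO k); rewrite -?h //; lia|right].
have := battery cW; rewrite !in_setU in_setD arc_notin (frame_mem fr) => /(_ isT).
have ne : (C :\: carc i l) :|: W <> C.
  by rewrite /W setUA; apply: off_neq b2 ptR.
move=> /(_ ne); rewrite negSU // /W negSU // negSU //.
rewrite (battery_through b1 ptP) // (battery_through b2 ptR) // (negSD neg (arc_sub i l)).
have e1 : i <= k <= j by lia. have e2 : k <= j <= l by lia. have e3 : i <= k <= l by lia.
rewrite -(arcU e3) -(arcU e2) -(arcU e1) !negSU ?arc_disjoint //.
  by case: (negS (carc i k)); case: (negS (carc k j)); case: (negS (carc j l));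
     case: (negS (C :\: _)).
by rewrite (arcU e2) arc_disjoint.
Qed.

(** Rerouting along both bridges changes the sign twice. A shared attachment [j = k] is allowed. *)
Lemma battery_no_disjoint D1 F1 D2 F2 i j k l : isBridge C D1 F1 -> isBridge C D2 F2 ->
  att C F1 = [set c i; c j] -> att C F2 = [set c k; c l] ->
  i < j -> j <= k -> k < l -> l <= n -> False.
Proof.
move=> b1 b2 a1 a2 lij ljk lkl lln.
have lkn : k <= n by lia. have ljn : j <= n by lia. have lin : i <= n by lia.
have [|||P ptP] := @path_through_exists _ _ ends C D1 F1 (c i) (c j) b1;
  rewrite ?a1 ?set21 ?set22 //; first exact: coord_neq.
have [|||R ptR] := @path_through_exists _ _ ends C D2 F2 (c k) (c l) b2;
  rewrite ?a2 ?set21 ?set22 //; first exact: coord_neq.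
have pP := through_path ptP; have pR := through_path ptR.
have F12 : F1 <> F2.
  move=> h; have : c i \in att C F2 by rewrite -h a1 set21.
  rewrite a2 => /set2P[]/inj h'; first by have := h' lin lkn; lia.
  by have := h' lin lln; lia.
have PR x : x \in verts P -> x \in verts R -> x \in verts C.
  move=> xP xR; apply/negbNE/negP => xC; apply: F12.
  case: ptP => PF _ _ _ _; case: ptR => RF _ _ _ _.
  exact: bridge_eq_vertex b1 b2 (subsetP (vertsS _ PF) _ xP) (subsetP (vertsS _ RF) _ xR) xC.
(* The second rerouting starts from the circle [C1] produced by the first, which still contains the
   second arc. *)
have [c1 d1] := reroute b1 ptP lij ljn.
set C1 := _ :|: P in c1.
have A2C : carc k l \subset C :\: carc i j.
  apply/subsetP=> f fA; rewrite inE (subsetP (arc_sub k l) _ fA) andbT.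
  by rewrite (disjointFl (arc_disjoint i l ljk) fA).
have A2C1 : carc k l \subset C1 by apply: subset_trans A2C (subsetUl _ _).
have [p2 _] := circle_compl c1 A2C1 (arc_path lkl lln).
have dR : [disjoint R & C1].
  rewrite disjoint_sym -setI_eq0 setIUl setU_eq0 !setI_eq0; apply/andP; split.
    by rewrite disjoint_sym; apply: disjointWr (through_disjoint b2 ptR); apply: subsetDl.
  rewrite disjoint_subset; apply/subsetP=> f fP; rewrite inE; apply/negP => fR.
  case: ptP => PF _ _ _ _; case: ptR => RF _ _ _ _; apply: F12.
  by rewrite (bridge_eq b1 (subsetP PF _ fP)) (bridge_eq b2 (subsetP RF _ fR)).
have dR' : [disjoint C1 :\: carc k l & R].
  by rewrite disjoint_sym; apply: disjointWr dR; apply: subsetDl.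
have cW : isCircle ((C1 :\: carc k l) :|: R).
  apply: circle_of_paths p2 pR dR' _ => x /(subsetP (vertsS _ (subsetDl _ _))).
  rewrite vertsU in_setU => /orP[xO|xP] xR.
    exact: through_verts ptR xR (subsetP (vertsS _ (subsetDl _ _)) _ xO).
  exact: through_verts ptR xR (PR _ xP xR).
have := battery cW; rewrite in_setU in_setD arc_notin in_setU in_setD arc_notin.
rewrite (frame_mem fr) => /(_ isT (off_neq b2 ptR)).
rewrite negSU // (battery_through b2 ptR) //.
have := negSD neg A2C1; rewrite negSU // (battery_through b1 ptP) //.
have := negSD neg (arc_sub i j).
by case: (negS C); case: (negS (carc i j)); case: (negS (C :\: _)); case: (negS (carc k l));
   case: (negS _).
Qed.

End Battery.
End Frame.
End Coordinates.

(** * Chords, handles and layered circles *)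

Section Layered.
Variables (V E : finType) (ends : E -> V * V).

Local Notation src f := (ends f).1.
Local Notation tgt f := (ends f).2.
Local Notation incident := (incident ends).
Local Notation verts := (verts ends).
Local Notation isCircle := (isCircle ends).
Local Notation isPath := (isPath ends).
Local Notation isBridge := (isBridge ends).
Local Notation att := (att ends).
Local Notation attPt := (attPt ends).
Local Notation bridgeOf := (bridgeOf ends).
Local Notation pathThrough := (pathThrough ends).
Local Notation isHandle := (isHandle ends).
Local Notation crossing := (crossing ends).
Local Notation layered := (layered ends).
Implicit Types (F X Y Z P Q L R H A B : {set E}) (f g : E) (u v w x : V) (D T : {set V}).

Variables (C : {set E}) (e : E) (n : nat) (c : nat -> V) (d : nat -> E).
Hypothesis blk : isBlock ends.
Hypothesis fr : frame ends C e n c d.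
Hypothesis offC : exists f, f \notin C.

Let cC := frame_circle fr.
Let eC := frame_mem fr.
Local Notation carc := (carc n d).

Lemma off_noloop f : f \notin C -> src f != tgt f.
Proof. by move=> fC; apply: (block_noloop blk (g := e)); apply: contraNneq fC => <-. Qed.

Lemma coord_eq i j : i <= n -> j <= n -> (c i == c j) = (i == j).
Proof. by move=> li lj; apply/eqP/eqP => [/(frame_inj fr)->|->]. Qed.

(* {c i, c j} is a chord of C^* *)
Definition chordAt i j : bool :=
  [&& i < j, j <= n & [exists f, (f \notin C) && (att C (bridgeOf C f) == [set c i; c j])]].

Lemma chordAtP i j : reflect
  [/\ i < j, j <= n & exists D F, isBridge C D F /\ att C F = [set c i; c j]] (chordAt i j).
Proof.
apply: (iffP and3P) => -[lij ljn h]; split=> //.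
  have [f /andP[fC /eqP aF]] := existsP h.
  have [_ [D bD]] := bridgeOf_bridge fC (off_noloop fC).
  by exists D, (bridgeOf C f).
have [D [F [bD aF]]] := h.
have /vertsP[f fF _] : c i \in verts F.
  by have : c i \in att C F; [rewrite aF set21|rewrite in_setI => /andP[]].
apply/existsP; exists f; rewrite (bridge_notin bD fF) /=.
by rewrite -(bridge_eq bD fF) aF.
Qed.

Lemma bridge_chordAt D F i j : isBridge C D F -> att C F = [set c i; c j] ->
  i <= n -> j <= n -> i <> j -> chordAt (minn i j) (maxn i j).
Proof.
move=> bD aF li lj nij; apply/chordAtP; split; try lia.
exists D, F; split=> //; rewrite aF /minn /maxn; case: ifP => // _.
by rewrite setUC.
Qed.

Lemma attPt_coord v : attPt C v -> exists2 k, k <= n & v = c k.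
Proof. by case=> D [F [_]]; rewrite in_setI => /andP[/(coord_exists fr)]. Qed.

Lemma chordAt_attPt i j : chordAt i j -> attPt C (c i) /\ attPt C (c j).
Proof.
case/chordAtP=> _ _ [D [F [bD aF]]].
by split; exists D, F; rewrite aF ?set21 ?set22.
Qed.

(** Handles avoiding [e] are of the first kind, those containing [e] of the second. *)
Lemma handle_cases H : isHandle C H -> exists i j, chordAt i j /\
  ((H = carc i j /\ forall k, i < k < j -> ~ attPt C (c k)) \/
   (H = C :\: carc i j /\ forall k, k <= n -> k < i \/ j < k -> ~ attPt C (c k))).
Proof.
case=> u [w [[HC pH au aw inner] [D [F [bD aF]]]]].
have [i li uE] := attPt_coord au; have [j lj wE] := attPt_coord aw; subst u w.
wlog lij : i j li lj pH au aw inner aF / i < j.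
  move=> W; case: (ltngtP i j) => lij; first exact: (W i j).
    apply: (W j i) => //; [exact: path_sym| |by rewrite setUC].
    by move=> v vH vj vi; apply: inner.
  by have := path_neq pH; rewrite lij eqxx.
exists i, j; split.
  by apply/chordAtP; split=> //; exists D, F.
case: (arc_cases fr lij lj HC pH) => HE; [left|right]; split=> //.
  move=> k lk; apply: inner; rewrite ?HE ?(mem_verts_arc fr) ?coord_eq; lia.
move=> k lkn lk; apply: inner; rewrite ?HE ?(mem_verts_compl fr) ?coord_eq; lia.
Qed.

Lemma handle_arc i j : chordAt i j -> (forall k, i < k < j -> ~ attPt C (c k)) ->
  isHandle C (carc i j).
Proof.
move=> cij inner; have [ai aj] := chordAt_attPt cij.
case/chordAtP: (cij) => lij ljn [D [F [bD aF]]].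
exists (c i), (c j); split; last by exists D, F.
split=> //; [exact: arc_sub fr _ _|exact: (arc_path fr lij ljn)|].
move=> v /(verts_arc_coord fr lij ljn)[k lk ->]; rewrite !coord_eq; try lia.
by move=> ki kj; apply: inner; lia.
Qed.

Lemma handle_compl i j : chordAt i j ->
  (forall k, k <= n -> k < i \/ j < k -> ~ attPt C (c k)) -> isHandle C (C :\: carc i j).
Proof.
move=> cij inner; have [ai aj] := chordAt_attPt cij.
case/chordAtP: (cij) => lij ljn [D [F [bD aF]]].
exists (c i), (c j); split; last by exists D, F.
split=> //; [exact: subsetDl|exact: (arc_compl_path fr lij ljn)|].
move=> v vH; have [k lk vE] := coord_exists fr (subsetP (vertsS _ (subsetDl _ _)) _ vH).
move: vH; rewrite vE (mem_verts_compl fr) // !coord_eq //; try lia.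
by move=> h ki kj; apply: inner => //; lia.
Qed.

(** * Noncrossing chords: inner handles and separation *)

Section Noncrossing.
Hypothesis att2 : forall D F, isBridge C D F -> #|att C F| = 2.
Hypothesis noncrossing : forall i j k l,
  chordAt i j -> chordAt k l -> i < k -> k < j -> j < l -> False.

Lemma bridge_chord D F : isBridge C D F ->
  exists i j, chordAt i j /\ att C F = [set c i; c j].
Proof.
move=> bD; have /eqP/cards2P[u [w [nuw aF]]] := att2 bD.
have inC v : v \in att C F -> v \in verts C by rewrite in_setI => /andP[].
have uA : u \in att C F by rewrite aF set21.
have wA : w \in att C F by rewrite aF set22.
have [i li uE] := coord_exists fr (inC u uA).
have [j lj wE] := coord_exists fr (inC w wA); subst u w.
have nij : i <> j by move=> h; rewrite h eqxx in nuw.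
exists (minn i j), (maxn i j); split; first exact: bridge_chordAt bD aF li lj nij.
by rewrite /minn /maxn; case: ifP => // _; rewrite setUC.
Qed.

Lemma attPt_chord k : k <= n -> attPt C (c k) -> exists i j, chordAt i j /\ (k = i \/ k = j).
Proof.
move=> lk [D [F [bD kF]]]; have [i [j [cij aF]]] := bridge_chord bD.
exists i, j; split=> //; case/chordAtP: cij => lij ljn _.
have lin : i <= n by lia.
by move: kF; rewrite aF in_set2 !coord_eq // => /orP[]/eqP; auto.
Qed.

Lemma chord_exists : exists i j, chordAt i j.
Proof.
have [f fC] := offC; have [_ [D bD]] := bridgeOf_bridge fC (off_noloop fC).
by have [i [j [cij _]]] := bridge_chord bD; exists i, j.
Qed.

(** A chord with an end strictly between [i] and [j] is nested by noncrossing and shorter; descend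
    until there is none. *)
Lemma inner_handle i j : chordAt i j -> exists i' j',
  [/\ i <= i', j' <= j, chordAt i' j' & isHandle C (carc i' j')].
Proof.
move: {2}(j - i) (leqnn (j - i)) => m; elim: m i j => [|m IH] i j lm cij.
  by case/chordAtP: cij; lia.
case/chordAtP: (cij) => lij ljn _.
(* Bounding the positions by [n] makes the search for a nested chord decidable. *)
have [/existsP[k /existsP[l /andP[ckl h]]]|none] := boolP
  [exists k : 'I_n.+1, [exists l : 'I_n.+1, chordAt k l && ((i < k < j) || (i < l < j))]].
  case/chordAtP: (ckl) => lkl lln _.
  have lij' : i <= k /\ l <= j.
    case/orP: h => h.
      by split; [lia|]; rewrite leqNgt; apply/negP => jl; apply: (noncrossing cij ckl); lia.
    by split; [|lia]; rewrite leqNgt; apply/negP => ki; apply: (noncrossing ckl cij); lia.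
  have [|i' [j' [a b ? ?]]] := IH k l _ ckl; first by lia.
  by exists i', j'; split=> //; lia.
exists i, j; split=> //; apply: handle_arc => // k lk ak.
have lkn : k <= n by lia.
have [a [b [cab kab]]] := attPt_chord lkn ak.
case/chordAtP: (cab) => lab lbn _; case/existsP: none.
have lan : a < n.+1 by lia. have lbn' : b < n.+1 by lia.
exists (Ordinal lan); apply/existsP; exists (Ordinal lbn'); rewrite /= cab /=.
by case: kab => <-; rewrite lk ?orbT.
Qed.

Section OneInnerHandle.
Hypothesis handle_uniq : forall H H', isHandle C H -> isHandle C H' ->
  e \notin H -> e \notin H' -> H = H'.

(** [inner_handle] finds a handle avoiding [e] within the arc, and by uniqueness it is [H]. *)
Lemma handle_sub_arc H i j : isHandle C H -> e \notin H -> chordAt i j -> H \subset carc i j.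
Proof.
move=> hH eH cij; have [i' [j' [li lj c' h']]] := inner_handle cij.
by rewrite (handle_uniq hH h' eH (arc_notin fr _ _)); apply: (arcS fr).
Qed.

(** * The two sides of a bridge *)

Section Sides.
Variables (D : {set V}) (F : {set E}) (i j : nat).
Hypothesis bD : isBridge C D F.
Hypothesis aF : att C F = [set c i; c j].
Hypothesis cij : chordAt i j.

(* Bridges parallel to F (same attachments) are counted as inside. *)
Definition inside : {set E} := [set f | (f \notin F) &&
  ((f \in carc i j) || (f \notin C) && (att C (bridgeOf C f) \subset verts (carc i j)))].
Definition outside : {set E} := ~: (F :|: inside).

Let lij : i < j. Proof. by case/chordAtP: cij. Qed.
Let ljn : j <= n. Proof. by case/chordAtP: cij. Qed.

Lemma insideP f : reflect (f \notin F /\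
  (f \in carc i j \/ f \notin C /\ att C (bridgeOf C f) \subset verts (carc i j))) (f \in inside).
Proof.
rewrite [X in reflect _ X]in_set; apply: (iffP andP) => -[fF h]; split=> //.
  by case/orP: h => [|/andP[]]; auto.
by apply/orP; case: h => [|[-> ->]]; auto.
Qed.

Lemma arc_inside : carc i j \subset inside.
Proof.
apply/subsetP=> f fA; apply/insideP; split; last by left.
by apply: contraTN (subsetP (arc_sub fr i j) _ fA) => /(bridge_notin bD).
Qed.

Lemma e_outside : e \in outside.
Proof.
rewrite in_setC in_setU negb_or; apply/andP; split.
  by apply: contraTN eC => /(bridge_notin bD).
by apply/insideP => -[_ [|[]]]; [apply/negP/(arc_notin fr)|rewrite eC].
Qed.

Lemma off_bridge f v : incident f v -> v \notin verts C -> f \notin C.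
Proof. by move=> fv; apply: contraNN => fC; apply: mem_verts fC fv. Qed.

(** All edges at a vertex off [C] belong to the same bridge, so [F] meets other edges only at its
    attachments. *)
Lemma bridge_sep X x : [disjoint X & F] -> x \in verts F -> x \in verts X ->
  x = c i \/ x = c j.
Proof.
move=> dX xF xX; apply/set2P; rewrite -aF in_setI xF andbT.
apply: contraT => xC; have /vertsP[f fF fx] := xF; have /vertsP[g gX gx] := xX.
have gC := off_bridge gx xC; have [gg _] := bridgeOf_bridge gC (off_noloop gC).
move: gg; rewrite (bridgeOf_off gx xC) -(bridgeOf_off fx xC) -(bridge_eq bD fF).
by rewrite (disjointFr dX gX).
Qed.

(** Off [C], all edges at a vertex belong to one bridge, which lies on one side. On [C], the
    position of the vertex relative to [i] and [j] decides the side. *)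
Lemma side_sep x : x \in verts outside -> x \in verts inside -> x = c i \/ x = c j.
Proof.
case/vertsP=> f fo fx /vertsP[g gi gx].
move: fo; rewrite in_setC in_setU negb_or => /andP[fF fni].
have [xC|xC] := boolP (x \in verts C); last first.
  have fC := off_bridge fx xC; have gC := off_bridge gx xC.
  case/negP: fni; apply/insideP; split=> //; right; split=> //.
  rewrite (bridgeOf_off fx xC) -(bridgeOf_off gx xC).
  case/insideP: gi => _ [/(subsetP (arc_sub fr i j)) gC'|[]] //.
  by rewrite gC' in gC.
have [k lk xE] := coord_exists fr xC; subst x.
have attE h : h \notin C -> incident h (c k) -> exists a b,
    [/\ chordAt a b, att C (bridgeOf C h) = [set c a; c b] & k = a \/ k = b].
  move=> hC hk; have [hh [D' bD']] := bridgeOf_bridge hC (off_noloop hC).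
  have [a [b [cab aE]]] := bridge_chord bD'; exists a, b; split=> //.
  have : c k \in att C (bridgeOf C h) by rewrite in_setI xC (mem_verts hh hk).
  case/chordAtP: cab => lab lbn _.
  have lan : a <= n by lia.
  by rewrite aE in_set2 !coord_eq // => /orP[]/eqP; auto.
have [->|ki] := eqVneq k i; first by left.
have [->|kj] := eqVneq k j; first by right.
(* Strictly between, every edge at [c k] not in [F] is inside: edges of [C] there lie in the arc,
   and noncrossing confines the chords at [c k] to it. *)
have [kin|kout] := boolP (i < k < j).
  case/negP: fni; apply/insideP; split=> //.
  have [fC|fC] := boolP (f \in C); [left|right].
    apply: contraT => fA.
    have : c k \in verts (C :\: carc i j) by apply: mem_verts fx; rewrite in_setD fA.
    by rewrite (mem_verts_compl fr) // kin.
  split=> //; have [a [b [cab aE kab]]] := attE f fC fx.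
  case/chordAtP: (cab) => lab lbn _.
  have [lia lbj] : i <= a /\ b <= j.
    case: kab => kab; subst k.
      by split; [lia|]; rewrite leqNgt; apply/negP => jb; apply: (noncrossing cij cab); lia.
    by split; [|lia]; rewrite leqNgt; apply/negP => ai; apply: (noncrossing cab cij); lia.
  by apply/subsetP=> y; rewrite aE => /set2P[]->; rewrite (mem_verts_arc fr) //; lia.
(* Beyond the arc no inside edge reaches [c k]. *)
exfalso; case/insideP: gi => _ [gA|[gC gS]].
  by have := mem_verts gA gx; rewrite (mem_verts_arc fr) //; lia.
have [a [b [cab aE kab]]] := attE g gC gx.
have : c k \in verts (carc i j).
  by apply: (subsetP gS); rewrite aE; case: kab => ->; rewrite ?set21 ?set22.
by rewrite (mem_verts_arc fr) //; lia.
Qed.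

Lemma sides_disjoint : [/\ [disjoint outside & F], [disjoint inside & F] &
  [disjoint outside & inside]].
Proof.
split; rewrite disjoint_subset; apply/subsetP => f; rewrite [f \in predC _]inE.
- by rewrite in_setC in_setU negb_or => /andP[].
- by case/insideP.
- by rewrite in_setC in_setU negb_or => /andP[].
Qed.

(* A circle meeting F, the inside and the outside would split into three
   paths from c i to c j, giving c i degree 3. *)
Lemma circle_avoids_inside C' f g : isCircle C' -> e \in C' -> f \in C' -> f \in F ->
  g \in C' -> g \notin inside.
Proof.
move=> cC' eC' fC' fF gC'; apply/negP => gi.
have [dOF dIF dOI] := sides_disjoint.
pose X1 := C' :&: outside; pose X2 := C' :&: inside; pose X3 := C' :&: F.
have tot h : (h \in outside) || (h \in inside) || (h \in F).
  by rewrite in_setC in_setU; case: (h \in F); case: (h \in inside).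
have CE : X1 :|: X2 :|: X3 = C' by rewrite -!setIUr; apply/setIidPl/subsetP=> h _; rewrite !in_setU.
have d12 : [disjoint X1 & X2] by apply: disjointW dOI; apply: subsetIr.
have d13 : [disjoint X1 & X3] by apply: disjointW dOF; apply: subsetIr.
have d23 : [disjoint X2 & X3] by apply: disjointW dIF; apply: subsetIr.
have n1 : X1 != set0 by apply/set0Pn; exists e; rewrite in_setI eC' e_outside.
have n2 : X2 != set0 by apply/set0Pn; exists g; rewrite in_setI gC'.
have n3 : X3 != set0 by apply/set0Pn; exists f; rewrite in_setI fC'.
have vI (X Y : {set E}) x : x \in verts (X :&: Y) -> x \in verts Y.
  by apply/subsetP/vertsS/subsetIr.
have nij : c i != c j by exact: (coord_neq fr lij ljn).
(* Each of the three classes is split off against the union of the other two. *)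
have [p1 _] : isPath X1 (c i) (c j) /\ isPath (X2 :|: X3) (c i) (c j).
  apply: circle_split cC' _ _ n1 _ nij _.
  - by rewrite setUA.
  - by rewrite disjoint_sym -setI_eq0 setIUl setU_eq0 !setI_eq0 ![[disjoint _ & X1]]disjoint_sym d12.
  - by rewrite setU_eq0 (negbTE n2).
  move=> x /vI x1; rewrite vertsU in_setU => /orP[]/vI; first exact: side_sep.
  by move=> xF; apply: (bridge_sep dOF).
have [p2 _] : isPath X2 (c i) (c j) /\ isPath (X1 :|: X3) (c i) (c j).
  apply: circle_split cC' _ _ n2 _ nij _.
  - by rewrite setUA [X2 :|: X1]setUC.
  - by rewrite disjoint_sym -setI_eq0 setIUl setU_eq0 !setI_eq0 d12 disjoint_sym.
  - by rewrite setU_eq0 (negbTE n1).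
  move=> x /vI x2; rewrite vertsU in_setU => /orP[]/vI; first by move=> x1; apply: side_sep.
  by move=> xF; apply: (bridge_sep dIF).
have [p3 _] : isPath X3 (c i) (c j) /\ isPath (X1 :|: X2) (c i) (c j).
  apply: circle_split cC' _ _ n3 _ nij _.
  - by rewrite setUC.
  - by rewrite disjoint_sym -setI_eq0 setIUl setU_eq0 !setI_eq0 d13 d23.
  - by rewrite setU_eq0 (negbTE n1).
  move=> x /vI xF; rewrite vertsU in_setU => /orP[]/vI; first exact: bridge_sep.
  exact: bridge_sep.
have d123 : [disjoint X1 :|: X2 & X3] by rewrite -setI_eq0 setIUl setU_eq0 !setI_eq0 d13 d23.
have := degU ends (c i) d123; rewrite CE degU // (path_degl p1) (path_degl p2) (path_degl p3).
have [_ dC] := cC'; rewrite dC //.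
have C1 : X1 \subset C' by apply: subsetIl.
exact: (subsetP (vertsS _ C1) _ (path_l p1)).
Qed.

End Sides.

Lemma off_circle C' : isCircle C' -> C' <> C -> exists f D i j,
  [/\ f \in C', f \in bridgeOf C f, isBridge C D (bridgeOf C f), chordAt i j &
      att C (bridgeOf C f) = [set c i; c j]].
Proof.
move=> cC' ne; have [sub|/subsetPn[f fC' fC]] := boolP (C' \subset C).
  case: ne; apply: even_sub_circle cC sub _ _; first by case: cC' => -[].
  by move=> v; rewrite (circle_odd v cC').
have [ff [D bD]] := bridgeOf_bridge fC (off_noloop fC).
have [i [j [cij aE]]] := bridge_chord bD.
by exists f, D, i, j.
Qed.

(** A circle other than [C] uses a bridge and so avoids its inside, which contains the arc it spans
    and hence [H]. *)
Lemma circle_through_both H b C' : isHandle C H -> e \notin H -> b \in H ->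
  isCircle C' -> e \in C' -> b \in C' -> C' = C.
Proof.
move=> hH eH bH cC' eC' bC'; apply/eqP; apply: contraT => /eqP ne.
have [f [D [i [j [fC' ff bD cij aF]]]]] := off_circle cC' ne.
have := circle_avoids_inside bD aF cij cC' eC' fC' ff bC'.
by rewrite (subsetP (arc_inside i j bD)) // (subsetP (handle_sub_arc hH eH cij)).
Qed.

Lemma circle_through C' : isCircle C' -> e \in C' -> C' <> C -> exists D F P Q u w,
  [/\ isBridge C D F, pathThrough C F P u w, Q \subset C, isPath Q u w & C' = P :|: Q].
Proof.
move=> cC' eC' ne.
have [f [D [i [j [fC' ff bD cij aF]]]]] := off_circle cC' ne.
case/chordAtP: (cij) => lij ljn _.
set F := bridgeOf C f in ff bD aF.
have noI g : g \in C' -> g \notin inside F i j.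
  exact: (circle_avoids_inside bD aF cij cC' eC' fC' ff).
have [dOF dIF dOI] := sides_disjoint F i j.
pose X := C' :&: outside F i j; pose P := C' :&: F.
have CE : X :|: P = C'.
  rewrite -setIUr; apply/setIidPl/subsetP=> h hC'; rewrite in_setU in_setC in_setU.
  by rewrite (negbTE (noI _ hC')); case: (h \in F).
have dXP : [disjoint X & P] by apply: disjointW dOF; apply: subsetIr.
have eX : e \in X by rewrite in_setI eC' (e_outside _ _ bD).
have nX : X != set0 by apply/set0Pn; exists e.
have nP : P != set0 by apply/set0Pn; exists f; rewrite in_setI fC'.
have vI (Y Z : {set E}) x : x \in verts (Y :&: Z) -> x \in verts Z.
  by apply/subsetP/vertsS/subsetIr.
have nij : c i != c j by exact: (coord_neq fr lij ljn).
have [pX pP] : isPath X (c i) (c j) /\ isPath P (c i) (c j).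
  apply: (circle_split cC' CE dXP nX nP nij) => x /vI x1 /vI x2.
  exact: (bridge_sep bD aF dOF).
(* Closing [X] by the arc instead of by [P] gives a circle through [e] and an inner handle. It must
   be [C], whence [X] lies in [C]. *)
have cXA : isCircle (X :|: carc i j).
  apply: circle_of_paths pX (arc_path fr lij ljn) _ _.
    by apply: disjointW dOI; [apply: subsetIr|apply: arc_inside i j bD].
  move=> x /vI x1 /(subsetP (vertsS _ (arc_inside i j bD))) x2.
  exact: (side_sep cij x1 x2).
have [i' [j' [li lj c' h']]] := inner_handle cij.
case/chordAtP: (c') => lij' ljn' _.
have [b bA] := path_n0 (arc_path fr lij' ljn').
have XA : X :|: carc i j = C.
  apply: (circle_through_both h' (arc_notin fr _ _) bA cXA); first by rewrite in_setU eX.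
  by rewrite in_setU (subsetP (arcS fr li lj) _ bA) orbT.
have FC x : (x \in verts C) && (x \in verts F) = (x \in [set c i; c j]) by rewrite -aF in_setI.
have uC : c i \in att C F by rewrite aF set21.
have wC : c j \in att C F by rewrite aF set22.
exists D, F, P, X, (c i), (c j); split=> //.
- split=> //; first exact: subsetIr.
  apply/setP=> x; rewrite -FC in_setI andbC; apply: andb_id2l => xC.
  apply/idP/idP => [/vI//|xF]; have := FC x; rewrite xC xF /= => /esym/set2P[]->.
    exact: path_l pP.
  exact: path_r pP.
- by rewrite -XA subsetUl.
- by rewrite setUC.
Qed.

End OneInnerHandle.
End Noncrossing.

Lemma noncrossing_of_layered : layered C -> forall i j k l,
  chordAt i j -> chordAt k l -> i < k -> k < j -> j < l -> False.
Proof.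
move=> [_ [nox _]] i j k l /chordAtP[lij ljn [D1 [F1 [b1 a1]]]].
case/chordAtP=> lkl lln [D2 [F2 [b2 a2]]] lik lkj ljl.
apply: (nox _ _ _ _ _ _ _ _ b1 b2 a1 a2).
have lin : i <= n by lia. have lkn : k <= n by lia.
split; first by rewrite !coord_eq //; lia.
  by rewrite !(coord_mem fr).
move=> Q QC pQ; case: (arc_cases fr lij ljn QC pQ) => ->.
  by rewrite !(mem_verts_arc fr) //; lia.
by rewrite !(mem_verts_compl fr) //; lia.
Qed.

(** One of the two handles contains [e], so at most one avoids it. *)
Lemma handle_uniq_of_layered : layered C -> (exists H, isHandle C H /\ e \in H) ->
  forall H H', isHandle C H -> isHandle C H' -> e \notin H -> e \notin H' -> H = H'.
Proof.
move=> [_ [_ [H1 [H2 [_ _ _ only]]]]] [H0 [h0 e0]] H H' /only h /only h' eH eH'.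
case/only: h0 => h0; subst H0.
  case: h => h; first by rewrite h e0 in eH.
  by case: h' => h'; [rewrite h' e0 in eH'|rewrite h h'].
case: h => h; last by rewrite h e0 in eH.
by case: h' => h'; [rewrite h h'|rewrite h' e0 in eH'].
Qed.

Lemma no_crossing :
  (forall i j k l, chordAt i j -> chordAt k l -> i < k -> k < j -> j < l -> False) ->
  forall D1 F1 D2 F2 u w x y, isBridge C D1 F1 -> isBridge C D2 F2 ->
    att C F1 = [set u; w] -> att C F2 = [set x; y] -> ~ crossing C u w x y.
Proof.
move=> noX D1 F1 D2 F2 u w x y b1 b2 a1 a2 [ne mem sep].
case/and4P: mem => /(coord_exists fr)[i li uE] /(coord_exists fr)[j lj wE].
case/(coord_exists fr)=> k lk xE /(coord_exists fr)[l ll yE]; subst u w x y.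
move: ne; rewrite !coord_eq // => ne.
have nij : i <> j by lia. have nkl : k <> l by lia.
have c1 := bridge_chordAt b1 a1 li lj nij.
have c2 := bridge_chordAt b2 a2 lk ll nkl.
have lmM : minn i j < maxn i j by lia.
have lMn : maxn i j <= n by lia.
have pA : isPath (carc (minn i j) (maxn i j)) (c i) (c j).
  have := arc_path fr lmM lMn; rewrite /minn /maxn; case: ifP => // _; exact: path_sym.
have := sep _ (arc_sub fr _ _) pA; rewrite !(mem_verts_arc fr) // => s.
(* With four distinct positions, separation leaves only the two interleavings. *)
have [h|h] : (minn i j < minn k l /\ minn k l < maxn i j /\ maxn i j < maxn k l) \/
   (minn k l < minn i j /\ minn i j < maxn k l /\ maxn k l < maxn i j) by lia.
  by apply: (noX _ _ _ _ c1 c2); lia.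
by apply: (noX _ _ _ _ c2 c1); lia.
Qed.

(** * Overlapping noncrossing chords leave exactly two handles *)

Section TwoHandled.
Hypothesis att2 : forall D F, isBridge C D F -> #|att C F| = 2.
Hypothesis noncrossing : forall i j k l,
  chordAt i j -> chordAt k l -> i < k -> k < j -> j < l -> False.
Hypothesis overlap : forall i j k l, chordAt i j -> chordAt k l -> k < j.

(** Dual to [inner_handle]: ascend to longer chords. Here noncrossing alone does not force nesting,
    since a chord beyond [j] could be disjoint; [overlap] excludes this. *)
Lemma outer_handle i j : chordAt i j ->
  exists i' j', chordAt i' j' /\ isHandle C (C :\: carc i' j').
Proof.
move: {2}(n - (j - i)) (leqnn (n - (j - i))) => m; elim: m i j => [|m IH] i j lm cij.
  exists i, j; split=> //; apply: handle_compl => // k lk h.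
  by case/chordAtP: cij; lia.
case/chordAtP: (cij) => lij ljn _.
have [/existsP[k /existsP[l /andP[ckl h]]]|none] := boolP
  [exists k : 'I_n.+1, [exists l : 'I_n.+1, chordAt k l && ((k < i) || (j < l))]].
  case/chordAtP: (ckl) => lkl lln _.
  have o1 := overlap cij ckl; have o2 := overlap ckl cij.
  have lij' : k <= i /\ j <= l.
    case/orP: h => h.
      by split; [lia|]; rewrite leqNgt; apply/negP => lj; apply: (noncrossing ckl cij); lia.
    by split; [|lia]; rewrite leqNgt; apply/negP => ik; apply: (noncrossing cij ckl); lia.
  by apply: (IH k l _ ckl); lia.
exists i, j; split=> //; apply: handle_compl => // k lkn lk ak.
have [a [b [cab kab]]] := attPt_chord att2 lkn ak.
case/chordAtP: (cab) => lab lbn _; case/existsP: none.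
have o1 := overlap cij cab; have o2 := overlap cab cij.
have lan : a < n.+1 by lia. have lbn' : b < n.+1 by lia.
exists (Ordinal lan); apply/existsP; exists (Ordinal lbn'); rewrite /= cab /=.
by lia.
Qed.

Lemma layered_of_overlap : layered C /\ exists H1 H2,
  [/\ isHandle C H1, e \notin H1, isHandle C H2 & e \in H2].
Proof.
have [i [j cij]] := chord_exists att2.
have [i0 [j0 [_ _ c0 h0]]] := inner_handle att2 noncrossing cij.
have [i1 [j1 [c1 h1]]] := outer_handle cij.
have e0 : e \notin carc i0 j0 := arc_notin fr _ _.
have e1 : e \in C :\: carc i1 j1 by rewrite in_setD (arc_notin fr) eC.
split; last by exists (carc i0 j0), (C :\: carc i1 j1).
split=> //; split; first exact: no_crossing.
exists (carc i0 j0), (C :\: carc i1 j1); split=> //; first by move=> h; rewrite h e1 in e0.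
(* An arc without inner attachments lies within every chord arc, so two such arcs contain each
   other. *)
have inner_uniq i2 j2 i3 j3 : chordAt i2 j2 -> chordAt i3 j3 ->
    (forall k, i2 < k < j2 -> ~ attPt C (c k)) -> i3 <= i2 /\ j2 <= j3.
  move=> c2 c3 no; have [a b] := chordAt_attPt c3.
  have o1 := overlap c2 c3; have o2 := overlap c3 c2.
  case/chordAtP: c3 => ? _ _; split; rewrite leqNgt; apply/negP => h.
    by apply: (no i3) a; lia.
  by apply: (no j3) b; lia.
(* Dually, an arc without attachments beyond it contains every chord arc. *)
have outer_uniq i2 j2 i3 j3 : chordAt i2 j2 -> chordAt i3 j3 ->
    (forall k, k <= n -> k < i2 \/ j2 < k -> ~ attPt C (c k)) -> i2 <= i3 /\ j3 <= j2.
  move=> c2 c3 no; have [a b] := chordAt_attPt c3.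
  case/chordAtP: c3 => ? ? _; split; rewrite leqNgt; apply/negP => h.
    by apply: (no i3) a; lia.
  by apply: (no j3) b; lia.
have inner_of H : isHandle C H -> e \notin H -> exists i2 j2, [/\ chordAt i2 j2,
    H = carc i2 j2 & forall k, i2 < k < j2 -> ~ attPt C (c k)].
  move=> hH eH; have [i2 [j2 [c2 [[HE no]|[HE no]]]]] := handle_cases hH.
    by exists i2, j2.
  by move: eH; rewrite HE in_setD (arc_notin fr) eC.
have outer_of H : isHandle C H -> e \in H -> exists i2 j2, [/\ chordAt i2 j2,
    H = C :\: carc i2 j2 & forall k, k <= n -> k < i2 \/ j2 < k -> ~ attPt C (c k)].
  move=> hH eH; have [i2 [j2 [c2 [[HE no]|[HE no]]]]] := handle_cases hH.
    by move: eH; rewrite HE (negbTE (arc_notin fr _ _)).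
  by exists i2, j2.
move=> H hH; have [eH|eH] := boolP (e \in H); [right|left].
  have [i2 [j2 [c2 -> no2]]] := outer_of _ hH eH.
  have [i3 [j3 [c3 -> no3]]] := outer_of _ h1 e1.
  have [a1 a2] := outer_uniq _ _ _ _ c2 c3 no2; have [a3 a4] := outer_uniq _ _ _ _ c3 c2 no3.
  by congr (_ :\: carc _ _); lia.
have [i2 [j2 [c2 -> no2]]] := inner_of _ hH eH.
have [i3 [j3 [c3 -> no3]]] := inner_of _ h0 e0.
have [a1 a2] := inner_uniq _ _ _ _ c2 c3 no2; have [a3 a4] := inner_uniq _ _ _ _ c3 c2 no3.
by congr (carc _ _); lia.
Qed.

End TwoHandled.
End Layered.

(** * Batteries *)

Section Batteries.
Variables (V E : finType) (ends : E -> V * V) (neg : E -> bool).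

Local Notation src f := (ends f).1.
Local Notation tgt f := (ends f).2.
Local Notation verts := (verts ends).
Local Notation isCircle := (isCircle ends).
Local Notation isPath := (isPath ends).
Local Notation isBridge := (isBridge ends).
Local Notation pathThrough := (pathThrough ends).
Local Notation isHandle := (isHandle ends).
Local Notation layered := (layered ends).
Local Notation negS := (negS neg).
Local Notation balancing := (balancing ends neg).
Implicit Types (F X Y Z P Q L R H A B : {set E}) (f g : E) (u v w x : V) (D T : {set V}).

Variables (C : {set E}) (e : E).
Hypothesis blk : isBlock ends.
Hypothesis cC : isCircle C.
Hypothesis eC : e \in C.
Hypothesis notCircle : ~ isCircleGraph ends.

(** If [C] were all of [E], only an isolated vertex could keep the graph from being a circle graph,
    and connectedness excludes one. *)
Lemma off_circle_edge : exists f, f \notin C.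
Proof.
have [CT|[f]] := set_0Vmem (~: C); last by rewrite in_setC; exists f.
have {}CT : C = setT by rewrite -setC0 -CT setCK.
case: notCircle; split; first by rewrite -CT.
apply/setP=> v; rewrite in_setT; apply/negbNE/negP => vT.
have C0 : C != set0 by apply/set0Pn; exists e.
have vC : v \notin verts C by rewrite CT.
have [f /compEdgesP[x xD fx]] := comp_edge blk C0 (comp_isComp vC).
have := comp_off (comp_isComp vC) xD; rewrite (@mem_verts _ _ ends C f) //.
by rewrite CT in_setT.
Qed.

Lemma frame_ex : exists n c d, frame ends C e n c d.
Proof.
have [f fC] := off_circle_edge; apply: frame_exists => //.
by apply: (block_noloop blk (g := f)); apply: contraNneq fC => ->.
Qed.

(** Switching preserves the signs of circles, and after switching [b] is the only negative edge. *)
Lemma balancing_circle b C' : balancing b -> isCircle C' -> negS C' = (b \in C').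
Proof.
case=> z zb cC'; rewrite negSE.
have zC' := circle_handshake z cC'.
have {}zb f : neg f = (f == b) (+) (z (src f) (+) z (tgt f)).
  by have := zb f; case: (neg f); case: (f == b); case: (z _); case: (z _).
rewrite (eq_bigr _ (fun f _ => zb f)) big_split /= zC'; rewrite addbF; have [bC'|bC'] := boolP (b \in C').
  by rewrite (bigD1 b) //= eqxx big1 // => f /andP[_ /negbTE].
by rewrite big1 // => f fC'; apply/negbTE; apply: contraNneq bC' => <-.
Qed.

(** * From layered circles to batteries *)

Section Layered.
Hypothesis lay : layered C.
Hypothesis inH : exists H, isHandle C H /\ e \in H.

Lemma layered_handle_circle H b C' : isHandle C H -> e \notin H -> b \in H ->
  isCircle C' -> e \in C' -> b \in C' -> C' = C.
Proof.
have [n [c [d fr]]] := frame_ex.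
apply: (circle_through_both blk fr (proj1 lay)
  (noncrossing_of_layered blk fr lay) (handle_uniq_of_layered lay inH)).
Qed.

Lemma layered_circle_through C' : isCircle C' -> e \in C' -> C' <> C ->
  exists D F P Q u w,
  [/\ isBridge C D F, pathThrough C F P u w, Q \subset C, isPath Q u w & C' = P :|: Q].
Proof.
have [n [c [d fr]]] := frame_ex.
apply: (circle_through blk fr (proj1 lay)
  (noncrossing_of_layered blk fr lay) (handle_uniq_of_layered lay inH)).
Qed.

Lemma handle_subC H : isHandle C H -> H \subset C.
Proof. by case=> u [w [[]]]. Qed.

(** The negative circles are those through [b], and only [C] contains both [e] and [b]. *)
Lemma negBattery_of_balancing H b : isHandle C H -> e \notin H -> b \in H -> balancing b ->
  negBattery ends neg e C.
Proof.
move=> hH eH bH bal; split=> //.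
  by rewrite (balancing_circle bal cC) (subsetP (handle_subC hH)).
move=> C' cC' eC'; rewrite (balancing_circle bal cC') => bC'.
exact: (layered_handle_circle hH eH bH).
Qed.

Lemma posBattery_of_bridges :
  (forall D F, isBridge C D F -> forall P u w, pathThrough C F P u w ->
     forall Q : {set E}, Q \subset C -> isPath Q u w -> negS (P :|: Q)) ->
  posBattery ends neg e C.
Proof.
move=> cond; split=> //; last first.
  move=> C' cC' eC' nC'; apply/eqP; apply: contraT => /eqP ne.
  have [D [F [P [Q [u [w [bD ptP QC pQ CE]]]]]]] := layered_circle_through cC' eC' ne.
  by rewrite CE (cond _ _ bD _ _ _ ptP) in nC'.
(* Positivity of [C]: it is the sum of the two negative circles formed by a path through some
   bridge. *)
have [n [c [d fr]]] := frame_ex.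
have [i [j cij]] := chord_exists blk fr off_circle_edge (proj1 lay).
case/(chordAtP blk fr _ _): (cij) => lij ljn [D [F [bD aF]]].
have [|||P ptP] := @path_through_exists _ _ ends C D F (c i) (c j) bD;
  rewrite ?aF ?set21 ?set22 //; first exact: (coord_neq fr lij ljn).
have dP X : X \subset C -> [disjoint P & X].
  by move=> XC; apply: disjointWr (through_disjoint bD ptP).
have AC := arc_sub fr i j.
have := cond _ _ bD _ _ _ ptP _ AC (arc_path fr lij ljn).
have := cond _ _ bD _ _ _ ptP _ (subsetDl C _) (arc_compl_path fr lij ljn).
rewrite !negSU ?dP ?subsetDl // (negSD neg AC).
by case: (negS P); case: (negS _); case: (negS _).
Qed.

End Layered.

(** * From batteries to layered circles *)

Section Battery.
Hypothesis battery : forall C', isCircle C' -> e \in C' -> C' <> C -> negS C' = ~~ negS C.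

Lemma battery_layered : layered C /\ exists H1 H2,
  [/\ isHandle C H1, e \notin H1, isHandle C H2 & e \in H2].
Proof.
have [n [c [d fr]]] := frame_ex.
have C0 : C != set0 by apply/set0Pn; exists e.
apply: (layered_of_overlap blk fr off_circle_edge).
- move=> D F bD; apply/eqP; rewrite eqn_leq.
  by rewrite (battery_att_le2 fr battery bD) (bridge_att_gt1 blk C0 bD).
- move=> i j k l /(chordAtP blk fr _ _)[lij ljn [D1 [F1 [b1 a1]]]].
  case/(chordAtP blk fr _ _)=> lkl lln [D2 [F2 [b2 a2]]] lik lkj ljl.
  exact: (battery_no_cross fr battery b1 b2 a1 a2).
move=> i j k l /(chordAtP blk fr _ _)[lij ljn [D1 [F1 [b1 a1]]]].
case/(chordAtP blk fr _ _)=> lkl lln [D2 [F2 [b2 a2]]].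
rewrite ltnNge; apply/negP => ljk.
exact: (battery_no_disjoint fr battery b1 b2 a1 a2).
Qed.

(* Flipping the sign of b makes every circle through e positive, and in a block
   this forces balance. *)
Lemma battery_balancing H b : negS C -> isHandle C H -> e \notin H -> b \in H ->
  balancing b.
Proof.
move=> nC hH eH bH; have [lay [H1 [H2 [h1 e1 h2 e2]]]] := battery_layered.
have inH : exists H, isHandle C H /\ e \in H by exists H2.
pose neg' f := neg f (+) (f == b).
have negE C' : Defs.negS neg' C' = negS C' (+) (b \in C').
  rewrite !negSE big_split /=; congr (_ (+) _).
  have [bC'|bC'] := boolP (b \in C').
    by rewrite (bigD1 b) //= eqxx big1 // => f /andP[_ /negbTE].
  by rewrite big1 // => f fC'; apply/negbTE; apply: contraNneq bC' => <-.
have [g gC] := off_circle_edge.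
have ge : exists g, g != e by exists g; apply: contraNneq gC => ->.
have [|z zT] := @potential_of_circles _ _ ends blk neg' e C cC eC ge.
  move=> C' cC' eC'; rewrite negE; have [->|/eqP ne] := eqVneq C' C.
    by rewrite nC (subsetP (handle_subC hH) _ bH).
  rewrite (battery cC' eC' ne) nC /=; apply/negbTE/negP => bC'; apply: ne.
  exact: (layered_handle_circle lay inH hH eH bH).
exists z => f; have := zT f (in_setT f); rewrite /neg'.
by case: (neg f); case: (f == b); case: (z _); case: (z _).
Qed.

(** Of the two circles formed by [P], the one through [e] is negative by the battery property; the
    other is its sum with the positive [C]. *)
Lemma battery_bridge_negative D F P u w Q : ~~ negS C -> isBridge C D F ->
  pathThrough C F P u w -> Q \subset C -> isPath Q u w -> negS (P :|: Q).
Proof.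
move=> nC bD ptP.
have through_e R : R \subset C -> isPath R u w -> e \in R -> negS (P :|: R).
  move=> RC pR eR; have dP := disjointWr RC (through_disjoint bD ptP).
  rewrite (battery _ _) //; first last.
  - by rewrite setUC; apply: (off_neq bD ptP).
  - by rewrite in_setU eR orbT.
  apply: circle_of_paths (through_path ptP) pR dP _ => x xP xR.
  exact: through_verts ptP xP (subsetP (vertsS _ RC) _ xR).
move=> QC pQ; have [eQ|eQ] := boolP (e \in Q); first exact: through_e.
have [pR _] := circle_compl cC QC pQ.
have := through_e _ (subsetDl C Q) pR; rewrite in_setD eQ eC => /(_ isT).
have dP X : X \subset C -> [disjoint P & X].
  by move=> XC; apply: disjointWr (through_disjoint bD ptP).
rewrite !negSU ?dP ?subsetDl //; move: nC; rewrite (negSD neg QC).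
by case: (negS P); case: (negS Q); case: (negS _).
Qed.

End Battery.
End Batteries.

Theorem mainTheorem3 (V E : finType) (ends : E -> V * V) (neg : E -> bool)
    (e : E) (C : {set E}) :
  isBlock ends -> ~ isSingleEdge ends -> ~ isCircleGraph ends ->
  isCircle ends C -> e \in C ->
  let inHandle := exists H, isHandle ends C H /\ e \in H in
  let cond1 := exists H, [/\ isHandle ends C H, e \notin H &
                  exists b, b \in H /\ balancing ends neg b] in
  let cond2 := forall D F, isBridge ends C D F ->
                 forall P u w, pathThrough ends C F P u w ->
                 forall Q : {set E}, Q \subset C -> isPath ends Q u w ->
                   negS neg (P :|: Q) in
  [/\ (negBattery ends neg e C \/ posBattery ends neg e C) <->
        (layered ends C /\ inHandle /\ (cond1 \/ cond2)),
      (layered ends C /\ inHandle /\ cond1 -> negBattery ends neg e C) &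
      (layered ends C /\ inHandle /\ cond2 -> posBattery ends neg e C)].
Proof.
move=> blk _ notC cC eC inHandle cond1 cond2.
have neg_of : layered ends C /\ inHandle /\ cond1 -> negBattery ends neg e C.
  case=> lay [inH [H [hH eH [b [bH bal]]]]].
  exact: (negBattery_of_balancing blk cC eC notC lay inH hH eH bH bal).
have pos_of : layered ends C /\ inHandle /\ cond2 -> posBattery ends neg e C.
  by case=> lay [inH c2]; apply: (posBattery_of_bridges blk cC eC notC lay inH).
split=> //; split; last first.
  by case=> lay [inH [c1|c2]]; [left; apply: neg_of|right; apply: pos_of].
(* Uniqueness among circles of sign [s] through [e] means that all the others have the opposite
   sign; this covers both kinds of battery. *)
have battery_of (s : bool) : negS neg C = s ->
    (forall C', isCircle ends C' -> e \in C' -> negS neg C' = s -> C' = C) ->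
  forall C', isCircle ends C' -> e \in C' -> C' <> C -> negS neg C' = ~~ negS neg C.
  move=> sC uniq C' cC' eC' ne; rewrite sC; apply/eqP; apply: contraT => h.
  by case: ne; apply: uniq => //; move: h; case: (s); case: (negS neg C').
case=> [[_ _ nC uniq]|[_ _ nC uniq]].
  have bat := battery_of true nC uniq.
  have [lay [H1 [H2 [h1 e1 h2 e2]]]] := battery_layered blk cC eC notC bat.
  split=> //; split; first by exists H2.
  left; exists H1; split=> //.
  have [u [w [[_ pH _ _ _] _]]] := h1; have [b bH] := path_n0 pH.
  by exists b; split=> //; apply: (battery_balancing blk cC eC notC bat nC h1).
have bat : forall C', isCircle ends C' -> e \in C' -> C' <> C -> negS neg C' = ~~ negS neg C.
  apply: (battery_of false); first exact: negbTE.
  by move=> C' cC' eC' /negbT; apply: uniq.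
have [lay [H1 [H2 [h1 e1 h2 e2]]]] := battery_layered blk cC eC notC bat.
split=> //; split; first by exists H2.
right=> D F bD P u w ptP Q QC pQ.
exact: (battery_bridge_negative cC eC bat nC bD ptP QC pQ).
Qed.
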